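(* Let $m,p\in\mathbb N$ and $\omega>0$. Let $A,B\in\mathbb R^{m\times m}$ be constant matrices, let $f:\mathbb R\times\mathbb R^m\to\mathbb R^m$ and $h:\mathbb R^m\to\mathbb R^m$ be continuous, with $f(t+\omega,x)=f(t,x)$ for all $t\in\mathbb R$, $x\in\mathbb R^m$. Let $\{\theta_k\}_{k\in\mathbb Z}$ be a strictly increasing sequence of reals with $\theta_{k+p}=\theta_k+\omega$ for all $k\in\mathbb Z$. Let $\{\sigma_k\}_{k\in\mathbb Z}$ be a bounded sequence in $\mathbb R^m$, $\sup_k\|\sigma_k\|\le M_\sigma$ with $M_\sigma>0$, and define $g:\mathbb R\to\mathbb R^m$ by $g(t)=\sigma_k$ for $t\in(\theta_{kp},\theta_{(k+1)p}]$, $k\in\mathbb Z$. Consider the impulsive system $$\frac{dx}{dt}=Ax+f(t,x)+g(t),\ t\neq\theta_k,\qquad \Delta x|_{t=\theta_k}=Bx(\theta_k)+h(x(\theta_k)),$$ where $\Delta x|_{t=\theta_k}=x(\theta_k+)-x(\theta_k)$. Assume: (A1) $AB=BA$ and $\det(I+B)\neq0$; (A2) all eigenvalues of $A+\frac{p}{\omega}\log(I+B)$ have negative real parts; (A3) there are $M_f,M_h>0$ with $\sup_{t,x}\|f(t,x)\|\le M_f$ and $\sup_x\|h(x)\|\le M_h$; (A4) there are $L_f,L_h>0$ with $\|f(t,x_1)-f(t,x_2)\|\le L_f\|x_1-x_2\|$ for all $t,x_1,x_2$ and $\|h(x_1)-h(x_2)\|\le L_h\|x_1-x_2\|$ for all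 $x_1,x_2$; and let $N,\lambda>0$ be constants such that the matriciant $U(t,s)=e^{A(t-s)}(I+B)^{i([s,t))}$ ($t>s$), $U(s,s)=I$, of the linear system $x'=Ax$, $\Delta x|_{t=\theta_k}=Bx(\theta_k)$ satisfies $\|U(t,s)\|\le Ne^{-\lambda(t-s)}$ for all $t\ge s$, and assume moreover (A5) $N\left(\frac{L_f}{\lambda}+\frac{pL_h}{1-e^{-\lambda\omega}}\right)<1$; (A6) $NL_f+\frac{p}{\omega}\ln(1+NL_h)<\lambda$; (A7) $L_h\|(I+B)^{-1}\|<1$. If the sequence $\{\sigma_k\}_{k\in\mathbb Z}$ is unpredictable, then the impulsive system possesses a unique asymptotically stable unpredictable solution.
   Context: Norms are the Euclidean norm on vectors and the spectral norm on matrices. $i(J)$ denotes the number of terms of $\{\theta_k\}$ in the interval $J$. Solutions of the impulsive system are piecewise continuous functions, continuous except possibly at the $\theta_k$, left continuous at each $\theta_k$ with right limits $x(\theta_k+)$, satisfying the differential equation between impulse moments and the jump condition at each $\theta_k$. A bounded sequence $\{\sigma_k\}_{k\in\mathbb Z}$ is unpredictable if there exist $\delta_0>0$ and sequences $\{\zeta_n\}_{n\in\mathbb N}$, $\{\eta_n\}_{n\in\mathbb N}$ of positive integers, both diverging to infinity, such that $\|\sigma_{k+\zeta_n}-\sigma_k\|\to0$ as $n\to\infty$ for each $k$ in bounded intervals of integers, and $\|\sigma_{\zeta_n+\eta_n}-\sigma_{\eta_n}\|\ge\delta_0$ for each $n$. Given a strictly increasing sequence $\{\theta_k\}$ with $\theta_{k+p}=\theta_k+\omega$,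 a piecewise continuous bounded function $\varphi:\mathbb R\to\mathbb R^m$ whose set of possible discontinuity points is $\{\theta_k\}$ and with $\lim_{t\to\theta_k^-}\varphi(t)=\varphi(\theta_k)$ for all $k$ is called unpredictable if there exist $\epsilon_0>0$, $r>0$ and sequences of reals $\{\mu_n\}$, $\{\tau_n\}$, both diverging to infinity, such that: (i) for every $\epsilon>0$ there is $\delta>0$ with $\|\varphi(s_1)-\varphi(s_2)\|<\epsilon$ whenever $s_1,s_2$ lie in the same interval of continuity and $|s_1-s_2|<\delta$; (ii) $\|\varphi(t+\mu_n)-\varphi(t)\|\to0$ as $n\to\infty$ uniformly on compact subsets of $\mathbb R$; (iii) $\|\varphi(t+\mu_n)-\varphi(t)\|\ge\epsilon_0$ for each $t\in[\tau_n-r,\tau_n+r]$ and $n\in\mathbb N$. *)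

(* Defs.v *)
From HB Require Import structures.
From mathcomp Require Import all_boot all_order all_algebra.
From mathcomp Require Import all_classical all_reals all_analysis.
From mathcomp Require Import complex.
Set Implicit Arguments. Unset Strict Implicit. Unset Printing Implicit Defensive.
Import Order.TTheory GRing.Theory Num.Theory.
Import numFieldNormedType.Exports.
Local Open Scope classical_set_scope.
Local Open Scope ring_scope.

Section Defs.
Variable R : realType.

Definition enorm {m : nat} (v : 'cV[R]_m) : R :=
  Num.sqrt (\sum_(i < m) (v i 0) ^+ 2).

Definition opnorm {m : nat} (M : 'M[R]_m) : R :=
  sup [set enorm (M *m v) | v in [set v : 'cV[R]_m | enorm v <= 1]].

Definition exp_psum {F : fieldType} {m : nat} (M : 'M[F]_m) (n : nat) : 'M[F]_m :=
  \sum_(k < n) (k`!%:R)^-1 *: M ^+ k.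

Definition mexp {m : nat} (M : 'M[R]_m) : 'M[R]_m :=
  \matrix_(i, j) limn (fun n => exp_psum M n i j).

Definition cmexp_is {m : nat} (L E : 'M[complex.complex R]_m) : Prop :=
  forall i j,
    (fun n => complex.Re (exp_psum L n i j)) @ \oo --> complex.Re (E i j) /\
    (fun n => complex.Im (exp_psum L n i j)) @ \oo --> complex.Im (E i j).

Definition cmx {m : nat} (M : 'M[R]_m) : 'M[complex.complex R]_m :=
  map_mx (fun a => complex.Complex a 0) M.

Definition icount (theta : int -> R) (s t : R) (n : nat) : Prop :=
  exists k0 : int, forall k : int,
    (s <= theta k /\ theta k < t) <-> (k0 <= k /\ k < k0 + n%:Z)%R.

Definition is_impulse (theta : int -> R) (t : R) : Prop :=
  exists k, t = theta k.

Variables (m : nat) (A B : 'M[R]_m) (f : R -> 'cV[R]_m -> 'cV[R]_m)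
  (g : R -> 'cV[R]_m) (h : 'cV[R]_m -> 'cV[R]_m) (theta : int -> R).

Definition rhs (t : R) (v : 'cV[R]_m) : 'cV[R]_m := A *m v + f t v + g t.

Definition jump_ok (x : R -> 'cV[R]_m) (k : int) : Prop :=
  exists r : 'cV[R]_m, x @ at_right (theta k) --> r /\
    r - x (theta k) = B *m x (theta k) + h (x (theta k)).

Definition solution_from (t0 : R) (x : R -> 'cV[R]_m) : Prop :=
  [/\ (forall t, t0 < t -> ~ is_impulse theta t -> is_derive t 1 x (rhs t (x t))),
      (~ is_impulse theta t0 -> x @ at_right t0 --> x t0),
      (forall k, t0 < theta k -> x @ at_left (theta k) --> x (theta k)) &
      (forall k, t0 <= theta k -> jump_ok x k)].

Definition solution (x : R -> 'cV[R]_m) : Prop :=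
  [/\ (forall t, ~ is_impulse theta t -> is_derive t 1 x (rhs t (x t))),
      (forall k, x @ at_left (theta k) --> x (theta k)) &
      (forall k, jump_ok x k)].

Definition asymp_stable (x : R -> 'cV[R]_m) : Prop :=
  forall t0 : R,
  (forall eps, 0 < eps -> exists2 delta, 0 < delta &
     forall y, solution_from t0 y -> enorm (y t0 - x t0) < delta ->
       forall t, t0 <= t -> enorm (y t - x t) < eps) /\
  (exists2 delta0, 0 < delta0 &
     forall y, solution_from t0 y -> enorm (y t0 - x t0) < delta0 ->
       (fun t => enorm (y t - x t)) @ +oo --> (0 : R)).
End Defs.

Definition unpredictable_seq (R : realType) (m : nat) (sigma : int -> 'cV[R]_m) : Prop :=
  (exists M : R, forall k, enorm (sigma k) <= M) /\
  exists delta0 : R, exists zeta et : nat -> nat,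
  [/\ 0 < delta0,
      (forall n, (0 < zeta n)%N /\ (0 < et n)%N),
      (forall M : nat, (\forall n \near \oo, (M <= zeta n)%N) /\
                       (\forall n \near \oo, (M <= et n)%N)),
      (forall a b : int, forall eps : R, 0 < eps -> \forall n \near \oo,
         forall k : int, (a <= k <= b)%R ->
           enorm (sigma (k + (zeta n)%:Z)%R - sigma k) < eps) &
      (forall n, delta0 <= enorm (sigma ((zeta n)%:Z + (et n)%:Z)%R - sigma (et n)%:Z))].

Definition unpredictable_fun (R : realType) (m : nat) (theta : int -> R)
    (phi : R -> 'cV[R]_m) : Prop :=
  [/\ (exists M : R, forall t, enorm (phi t) <= M),
      (forall t, ~ is_impulse theta t -> {for t, continuous phi}),
      (forall k, phi @ at_left (theta k) --> phi (theta k)),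
      (forall k, exists r : 'cV[R]_m, phi @ at_right (theta k) --> r) &
  exists eps0 r : R, exists mu tau : nat -> R,
  [/\ 0 < eps0 /\ 0 < r,
      (mu @ \oo --> +oo) /\ (tau @ \oo --> +oo),
      (forall eps, 0 < eps -> exists2 delta, 0 < delta &
         forall s1 s2, (exists k, theta k < s1 <= theta (k + 1) /\
                                  theta k < s2 <= theta (k + 1)) ->
           `|s1 - s2| < delta -> enorm (phi s1 - phi s2) < eps),
      (forall K : set R, compact K -> forall eps, 0 < eps ->
         \forall n \near \oo, forall t, K t ->
           enorm (phi (t + mu n) - phi t) < eps) &
      (forall n t, tau n - r <= t <= tau n + r ->
           eps0 <= enorm (phi (t + mu n) - phi t))]].

(* Main.v *)
(* The proof avoids the variation of constants formula. Discounting the matriciant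
   at rate lambda and taking the supremum over all later times gives a norm, between
   |.| and N |.|, in which the linear impulsive flow contracts exactly at rate lambda.
   Along the difference of two solutions this norm satisfies a one-sided differential
   inequality with rate lambda - N Lf, and an impulse multiplies it by at most
   1 + N Lh; by (A6), weighting the norm by a bounded function of the impulse index
   turns the map from one impulse moment to the next into a uniform contraction rho.
   Contraction alone gives the bounded solution (as limit of orbits started at zero
   in the remote past), its uniqueness among bounded solutions, its asymptotic
   stability, and the convergence of its shifts by zeta_n omega on compact sets.
   Separation of the shifts comes from the forcing term: on a piece where the two
   values of sigma differ by delta_0, the derivative of the difference is bounded
   away from zero as long as the difference is small. *)
Require Import Defs.
From HB Require Import structures.
From mathcomp Require Import all_boot all_order all_algebra.
From mathcomp Require Import all_classical all_reals all_analysis.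
From mathcomp Require Import complex.
From mathcomp Require Import ring lra zify.
Import Order.TTheory GRing.Theory Num.Theory.
Import numFieldNormedType.Exports.
Local Open Scope classical_set_scope.
Local Open Scope ring_scope.

(** * The Euclidean norm, its comparison with the sup norm of matrices, and the operator norm *)

Section EuclideanNorm.
Set Implicit Arguments. Unset Strict Implicit.
Variables (R : realType) (m : nat).
Implicit Types (u v : 'cV[R]_m) (M : 'M[R]_m).

(** A bound with constant [N] does not compose: used once per piece it would cost a factor [N] at
    every impulse, and no contraction would survive. In the adapted norm the linear flow and the
    linear jump have constant one, and [N] is charged only to the part of the motion that departs
    from them; this is the origin of [N * Lf] and [1 + N * Lh]. Being a supremum, this norm need not
    be differentiable, hence a comparison lemma for one-sided increments. Solutions are left
    continuous, so the value at [theta k] is the state before the impulse; estimates on a piece are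
    run on a copy whose value at [theta k] is replaced by the state after it. A shift by a multiple
    of [omega] solves the same system with a shifted [sigma], so one estimate for two solutions
    under different forcing serves uniqueness, stability and convergence of the shifts. *)

Lemma enorm_ge0 v : 0 <= enorm v.
Proof. exact: sqrtr_ge0. Qed.

Lemma sumsq_ge0 v : 0 <= \sum_(i < m) (v i 0) ^+ 2.
Proof. by apply: sumr_ge0 => i _; exact: sqr_ge0. Qed.

Lemma enorm_sqr v : enorm v ^+ 2 = \sum_(i < m) (v i 0) ^+ 2.
Proof. by rewrite sqr_sqrtr// sumsq_ge0. Qed.

Lemma coord_le_enorm v i : `|v i 0| <= enorm v.
Proof.
rewrite -sqrtr_sqr ler_wsqrtr// (bigD1 i)//= lerDl.
by apply: sumr_ge0 => j _; exact: sqr_ge0.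
Qed.

Lemma coord_le_norm v i : `|v i 0| <= `|v|.
Proof.
rewrite [leRHS]/Num.Def.normr/= mx_normrE.
exact: (le_bigmax _ (fun ij : 'I_m * 'I_1 => `|v ij.1 ij.2|) (i, 0)).
Qed.

Lemma norm_le_coord v e : 0 <= e -> (forall i, `|v i 0| <= e) -> `|v| <= e.
Proof.
move=> e0 H; rewrite [leLHS]/Num.Def.normr/= mx_normrE bigmax_le// => -[i j] _ /=.
by rewrite ord1.
Qed.

Lemma norm_le_enorm v : `|v| <= enorm v.
Proof. by apply: norm_le_coord => [|i]; [exact: enorm_ge0|exact: coord_le_enorm]. Qed.

Lemma enorm_le_norm v : enorm v <= m%:R * `|v|.
Proof.
have h : 0 <= m%:R * `|v| by rewrite mulr_ge0// normr_ge0.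
rewrite -(@ler_pXn2r _ 2)// ?nnegrE// ?enorm_ge0// enorm_sqr.
apply: (@le_trans _ _ (\sum_(i < m) `|v| ^+ 2)).
  apply: ler_sum => i _; rewrite -[v i 0 ^+ 2]real_normK ?num_real//.
  by rewrite ler_pXn2r ?nnegrE// coord_le_norm.
rewrite sumr_const card_ord exprMn -[leLHS]mulr_natl ler_wpM2r ?sqr_ge0//.
by rewrite -natrX ler_nat; case: (m) => // k; rewrite expnS leq_pmulr.
Qed.

Lemma enorm0 : enorm (0 : 'cV[R]_m) = 0.
Proof. by apply/le_anti; rewrite enorm_ge0 (le_trans (enorm_le_norm _))// normr0 mulr0. Qed.

Lemma enorm_eq0 v : enorm v <= 0 -> v = 0.
Proof.
move=> h; apply/eqP; rewrite -normr_le0.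
exact: le_trans (norm_le_enorm v) h.
Qed.

Lemma enormN v : enorm (- v) = enorm v.
Proof. by congr Num.sqrt; apply: eq_bigr => i _; rewrite mxE sqrrN. Qed.

Lemma enormBC u v : enorm (u - v) = enorm (v - u).
Proof. by rewrite -enormN opprB. Qed.

Lemma enormZ a v : enorm (a *: v) = `|a| * enorm v.
Proof.
rewrite -sqrtr_sqr -sqrtrM ?sqr_ge0//; congr Num.sqrt.
by rewrite mulr_sumr; apply: eq_bigr => i _; rewrite mxE exprMn.
Qed.

Lemma cauchy_schwarz u v : \sum_(i < m) u i 0 * v i 0 <= enorm u * enorm v.
Proof.
have [/enorm_eq0 ->|u0] := leP (enorm u) 0.
  by rewrite enorm0 mul0r big1// => i _; rewrite mxE mul0r.
have [/enorm_eq0 ->|v0] := leP (enorm v) 0.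
  by rewrite enorm0 mulr0 big1// => i _; rewrite mxE mulr0.
(* This product is the sum of the squares of the numbers [enorm v * u i 0 - enorm u * v i 0]; its
   positive factors then cancel. *)
suff : 0 <= 2 * (enorm u * enorm v) *
    (enorm u * enorm v - \sum_(i < m) u i 0 * v i 0).
  by rewrite pmulr_rge0 ?subr_ge0// !mulr_gt0.
have -> : 2 * (enorm u * enorm v) * (enorm u * enorm v - \sum_(i < m) u i 0 * v i 0)
    = \sum_(i < m) (enorm v * u i 0 - enorm u * v i 0) ^+ 2.
  transitivity (enorm v ^+ 2 * (\sum_(i < m) u i 0 ^+ 2) +
     enorm u ^+ 2 * (\sum_(i < m) v i 0 ^+ 2) -
     2 * (enorm u * enorm v) * \sum_(i < m) u i 0 * v i 0).
    by rewrite -!enorm_sqr; ring.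
  rewrite !mulr_sumr -big_split/= -sumrB; apply: eq_bigr => i _; ring.
by apply: sumr_ge0 => i _; exact: sqr_ge0.
Qed.

Lemma enormD u v : enorm (u + v) <= enorm u + enorm v.
Proof.
have h : 0 <= enorm u + enorm v by rewrite addr_ge0// enorm_ge0.
rewrite -(@ler_pXn2r _ 2)// ?nnegrE// ?enorm_ge0// sqrrD !enorm_sqr.
have -> : \sum_(i < m) (u + v) i 0 ^+ 2 = \sum_(i < m) u i 0 ^+ 2 +
    (\sum_(i < m) u i 0 * v i 0) *+ 2 + \sum_(i < m) v i 0 ^+ 2.
  by rewrite -sumrMnl -!big_split/=; apply: eq_bigr => i _; rewrite mxE sqrrD.
by rewrite lerD2r lerD2l lerMn2r/= cauchy_schwarz.
Qed.

Lemma enormB u v : enorm (u - v) <= enorm u + enorm v.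
Proof. by rewrite -(enormN v) enormD. Qed.

Lemma enorm_triangle w u v : enorm (u - v) <= enorm (u - w) + enorm (w - v).
Proof. by rewrite -[u - v](subrKA w) enormD. Qed.

(** A crude entrywise constant; adding one makes it positive, so that it can be divided by even for
    the zero matrix. *)
Lemma enorm_mulmx_bound M : exists2 K, 0 < K & forall v, enorm (M *m v) <= K * enorm v.
Proof.
exists (m%:R * (\sum_i \sum_j `|M i j|) + 1) => [|v].
  by rewrite ltr_wpDl// mulr_ge0// sumr_ge0// => i _; rewrite sumr_ge0.
apply: le_trans (enorm_le_norm _) _; rewrite mulrDl mul1r ler_wpDr ?enorm_ge0//.
rewrite -mulrA ler_wpM2l//; apply: norm_le_coord => [|i].
  by rewrite mulr_ge0 ?enorm_ge0// sumr_ge0// => i _; rewrite sumr_ge0.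
rewrite mxE; apply: le_trans (ler_norm_sum _ _ _) _.
apply: (@le_trans _ _ ((\sum_j `|M i j|) * enorm v)).
  rewrite mulr_suml; apply: ler_sum => j _.
  by rewrite normrM ler_wpM2l// coord_le_enorm.
rewrite ler_wpM2r ?enorm_ge0// [leRHS](bigD1 i)//= lerDl sumr_ge0// => k _.
exact: sumr_ge0.
Qed.

Lemma opnormP M v : enorm (M *m v) <= opnorm M * enorm v.
Proof.
have [v0|v0] := leP (enorm v) 0.
  by move/enorm_eq0: v0 => ->; rewrite mulmx0 enorm0 mulr0.
have -> : M *m v = enorm v *: (M *m ((enorm v)^-1 *: v)).
  by rewrite -scalemxAr scalerA mulfV ?scale1r// gt_eqF.
rewrite enormZ ger0_norm ?enorm_ge0// mulrC ler_wpM2r ?enorm_ge0//.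
(* [sup] dominates the members only of a set that is bounded above; the entrywise bound supplies
   this. *)
apply: ub_le_sup.
  have [K K0 HK] := enorm_mulmx_bound M; exists K => _ [w /= w1 <-].
  by apply: le_trans (HK w) _; rewrite ger_pMr.
exists ((enorm v)^-1 *: v) => //=.
by rewrite enormZ ger0_norm ?invr_ge0 ?enorm_ge0// mulVf ?gt_eqF.
Qed.

End EuclideanNorm.

(** * Limits and derivatives of vector functions in terms of the Euclidean norm *)

Section VectorCalculus.
Set Implicit Arguments. Unset Strict Implicit.
Variables (R : realType) (m : nat).
Implicit Types (X : R -> 'cV[R]_m) (d r : 'cV[R]_m) (t a e : R).

Lemma is_derive_colP X t d :
  is_derive t 1 X d <-> forall i, is_derive t 1 (fun s => X s i 0) (d i 0).
Proof.
split=> [[Xt <-] i|H].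
  have /derivable_mxP Xi := Xt.
  apply: DeriveDef; first exact: Xi.
  by rewrite derive_mx// mxE.
have Xt : derivable X t 1.
  by apply/derivable_mxP => i j; rewrite ord1; have [] := H i.
apply: DeriveDef => //; rewrite derive_mx//; apply/matrixP => i j.
by rewrite mxE ord1; have [_ ->] := H i.
Qed.

Lemma cvg_enormP (T : Type) (F : set_system T) (FF : Filter F) (X : T -> 'cV[R]_m) r :
  X x @[x --> F] --> r <->
  forall e, 0 < e -> \forall x \near F, enorm (X x - r) <= e.
Proof.
split=> [/cvgrPdist_le XF e e0|XF].
  (* Dividing by [m + 1] instead of [m] covers dimension zero. *)
  have m1 : 0 < m%:R + 1 :> R by rewrite ltr_wpDl.
  have /XF : 0 < e / (m%:R + 1) by rewrite divr_gt0.
  apply: filterS => x; rewrite distrC => H.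
  apply: le_trans (enorm_le_norm _) _.
  apply: (@le_trans _ _ (m%:R * (e / (m%:R + 1)))); first by rewrite ler_wpM2l.
  by rewrite mulrA ler_pdivrMr// mulrDr mulr1 mulrC lerDl ltW.
apply/cvgrPdist_le => e e0; apply: filterS (XF e e0) => x.
by rewrite distrC; apply: le_trans; exact: norm_le_enorm.
Qed.

Lemma at_right_enormP X a r : X @ at_right a --> r <->
  forall e, 0 < e -> exists2 dl, 0 < dl &
    forall s, a < s -> s < a + dl -> enorm (X s - r) <= e.
Proof.
split=> [/cvg_enormP H e e0|H].
  have [dl /= dl0 Hd] := H _ e0; exists dl => // s sa sd.
  by apply: Hd => //=; rewrite distrC ger0_norm ?subr_ge0 ?ltW// ltrBlDl.
apply/cvg_enormP => e /H[dl dl0 Hd]; exists dl => //= s /= sdl sa.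
by apply: Hd => //; move: sdl; rewrite ltr_norml => /andP[]; lra.
Qed.

Lemma at_left_enormP X a r : X @ at_left a --> r <->
  forall e, 0 < e -> exists2 dl, 0 < dl &
    forall s, s < a -> a - dl < s -> enorm (X s - r) <= e.
Proof.
split=> [/cvg_enormP H e e0|H].
  have [dl /= dl0 Hd] := H _ e0; exists dl => // s sa sd.
  by apply: Hd => //=; rewrite ger0_norm ?subr_ge0 ?ltW//; lra.
apply/cvg_enormP => e /H[dl dl0 Hd]; exists dl => //= s /= sdl sa.
by apply: Hd => //; move: sdl; rewrite ltr_norml => /andP[]; lra.
Qed.

Lemma continuous_enorm X a : {for a, continuous X} ->
  forall e, 0 < e -> exists2 dl, 0 < dl &
    forall s, `|s - a| < dl -> enorm (X s - X a) <= e.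
Proof.
move=> /cvg_enormP H e e0; have [dl /= dl0 Hd] := H _ e0.
by exists dl => // s; rewrite distrC => sd; exact: Hd.
Qed.

Lemma is_derive_enorm X t d : is_derive t 1 X d ->
  forall e, 0 < e -> exists2 dl, 0 < dl & forall h, `|h| < dl ->
    enorm (X (t + h) - X t - h *: d) <= e * `|h|.
Proof.
move=> [Xt Xd] e e0.
have : (fun h => h^-1 *: ((X \o shift t) (h *: 1) - X t)) @ 0^' --> d.
  by rewrite -Xd; exact: Xt.
move=> /cvg_enormP /(_ _ e0)[dl /= dl0 Hd].
exists dl => // h hd; have [->|h0] := eqVneq h 0.
  by rewrite addr0 subrr scale0r subrr enorm0 normr0 mulr0.
have /Hd /(_ h0) : `|0 - h| < dl by rewrite sub0r normrN.
rewrite /= [_%:A]mulr1 [h + t]addrC => H; apply: (@le_trans _ _ (`|h| * enorm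
    (h^-1 *: (X (t + h) - X t) - d))).
  by rewrite -enormZ scalerBr scalerA mulfV// scale1r.
by rewrite mulrC ler_wpM2r.
Qed.

Lemma is_derive_continuous X t d : is_derive t 1 X d -> {for t, continuous X}.
Proof. by move=> Xt; apply/differentiable_continuous/derivable1_diffP. Qed.

Lemma cvg_sum_ord n (u : 'I_n -> nat -> R) (l : 'I_n -> R) :
  (forall i, u i @ \oo --> l i) ->
  (fun k => \sum_(i < n) u i k) @ \oo --> \sum_(i < n) l i.
Proof. by move=> H; apply: cvg_big => [|i _]; [exact: add_continuous|exact: H]. Qed.

Lemma is_derive_mulmx_entry (q n k : nat) (F : R -> 'M[R]_(q, n))
    (G : R -> 'M[R]_(n, k)) (dF : 'M[R]_(q, n)) (dG : 'M[R]_(n, k)) t i j :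
  (forall l, is_derive t 1 (fun s => F s i l) (dF i l)) ->
  (forall l, is_derive t 1 (fun s => G s l j) (dG l j)) ->
  is_derive t 1 (fun s => (F s *m G s) i j) ((dF *m G t + F t *m dG) i j).
Proof.
move=> HF HG.
have -> : (fun s => (F s *m G s) i j) =
    \sum_l ((fun s => F s i l) * (fun s => G s l j)).
  by apply/funext => s; rewrite mxE fct_sumE.
have -> : (dF *m G t + F t *m dG) i j =
    \sum_l (F t i l *: dG l j + G t l j *: dF i l).
  rewrite !mxE -big_split/=; apply: eq_bigr => l _.
  by rewrite addrC [G t l j *: _]mulrC.
by apply: is_derive_sum => l; exact: is_deriveM.
Qed.

End VectorCalculus.

(** * The matrix exponential as a family of scalar power series *)

Section MatrixExponential.
Set Implicit Arguments. Unset Strict Implicit.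
Variables (R : realType) (m : nat) (A : 'M[R]_m).
Implicit Types (P Q : 'M[R]_m) (s t h : R) (x : 'cV[R]_m).

(** Taylor coefficients in [t] of the entry [i j] of [P *m mexp (t *: A)]. The left factor [P] makes
    the family closed under termwise differentiation, which replaces [P] by [P *m A]. *)
Let coef P i j k := (k`!%:R)^-1 * (P *m A ^+ k) i j.

Let exprS_mx k : A ^+ k.+1 = A *m A ^+ k.
Proof. exact: exprS. Qed.

Let psum_coef t n i j : exp_psum (t *: A) n i j = pseries (coef 1%:M i j) t n.
Proof.
rewrite /exp_psum /pseries/= /series/= big_mkord summxE; apply: eq_bigr => k _.
have -> : (t *: A) ^+ k = t ^+ k *: A ^+ k.
  elim: (nat_of_ord k) => [|l IH]; first by rewrite !expr0 scale1r.
  by rewrite exprS IH exprS_mx -[_ * _]/(_ *m _) -scalemxAl -scalemxAr scalerA exprS.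
rewrite !mxE /coef mul1mx; ring.
Qed.

(** Domination by the scalar exponential series of [K * |t|], where [K] bounds the action of [A];
    powers of [A] are estimated on the basis vector [e]. *)
Let cvg_pseries_coef P i j t : cvgn (pseries (coef P i j) t).
Proof.
have [K K0 HK] := enorm_mulmx_bound A.
have [L L0 HL] := enorm_mulmx_bound P.
pose e : 'cV[R]_m := delta_mx j 0.
have Ak k : enorm (A ^+ k *m e) <= K ^+ k * enorm e.
  elim: k => [|k IH]; first by rewrite !expr0 mul1mx mul1r.
  rewrite exprS_mx -mulmxA exprS -mulrA; apply: le_trans (HK _) _.
  by rewrite ler_pM2l.
have cb k : `|coef P i j k * t ^+ k| <= L * enorm e * exp_coeff (K * `|t|) k.
  rewrite /coef normrM normrX normrM ger0_norm ?invr_ge0//.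
  have -> : (P *m A ^+ k) i j = (P *m (A ^+ k *m e)) i 0.
    by rewrite mulmxA -[e]/(delta_mx j 0) -colE [RHS]mxE.
  have -> : exp_coeff (K * `|t|) k = K ^+ k * `|t| ^+ k / k`!%:R by rewrite -exprMn.
  have -> : L * enorm e * (K ^+ k * `|t| ^+ k / k`!%:R) =
      (k`!%:R)^-1 * (L * (K ^+ k * enorm e)) * `|t| ^+ k by ring.
  rewrite ler_wpM2r ?exprn_ge0// ler_wpM2l ?invr_ge0//.
  apply: le_trans (coord_le_enorm _ _) _; apply: le_trans (HL _) _.
  by rewrite ler_wpM2l// ltW.
have v0 k : 0 <= L * enorm e * exp_coeff (K * `|t|) k.
  apply: mulr_ge0; first by rewrite mulr_ge0 ?enorm_ge0 ?(ltW L0).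
  by apply: exp_coeff_ge0; rewrite mulr_ge0 ?(ltW K0).
apply: normed_cvg; apply: (series_le_cvg _ v0 cb) => [n|]; first exact: normr_ge0.
exact: (@is_cvg_seriesZ _ _ (L * enorm e) (is_cvg_series_exp_coeff (K * `|t|))).
Qed.

Let cvg_mul_mexp P i j t :
  pseries (coef P i j) t @ \oo --> (P *m mexp (t *: A)) i j.
Proof.
have H1 l : pseries (coef 1%:M l j) t @ \oo --> mexp (t *: A) l j.
  rewrite mxE (_ : (fun n => _) = pseries (coef 1%:M l j) t); last first.
    by apply/funext => n; rewrite psum_coef.
  exact: cvg_pseries_coef.
rewrite mxE (_ : pseries _ _ = fun n => \sum_l P i l * pseries (coef 1%:M l j) t n).
  by apply: cvg_sum_ord => l; apply: cvgM; [exact: cvg_cst|exact: H1].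
apply/funext => n; rewrite /pseries/= /series/=.
under [RHS]eq_bigr do rewrite mulr_sumr.
rewrite exchange_big/=; apply: eq_bigr => k _; rewrite /coef mxE mulr_sumr mulr_suml.
by apply: eq_bigr => l _; rewrite mul1mx; ring.
Qed.

Let diffs_coef P i j : pseries_diffs (coef P i j) = coef (P *m A) i j.
Proof.
apply/funext => k; rewrite /pseries_diffs /coef exprS_mx mulmxA factS natrM invfM.
by rewrite mulrA mulrA mulfV ?mul1r// pnatr_eq0.
Qed.

Lemma is_derive_mul_mexp P i j t :
  is_derive t 1 (fun s => (P *m mexp (s *: A)) i j) ((P *m A *m mexp (t *: A)) i j).
Proof.
have -> : (fun s => (P *m mexp (s *: A)) i j) = (fun s => limn (pseries (coef P i j) s)).
  by apply/funext => s; rewrite (cvg_lim _ (@cvg_mul_mexp P i j s)).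
rewrite -(cvg_lim _ (@cvg_mul_mexp (P *m A) i j t))// -diffs_coef.
apply: (@pseries_snd_diffs _ _ (`|t| + 1)); rewrite ?diffs_coef; try exact: cvg_pseries_coef.
by rewrite [ltRHS]ger0_norm ?addr_ge0// ltrDl.
Qed.

Lemma mexp_comm Q t : A *m Q = Q *m A -> mexp (t *: A) *m Q = Q *m mexp (t *: A).
Proof.
move=> AQ; apply/matrixP => i j.
have AkQ k : A ^+ k *m Q = Q *m A ^+ k.
  elim: k => [|k IH]; first by rewrite expr0 mulmx1 mul1mx.
  by rewrite exprS_mx -mulmxA IH mulmxA AQ mulmxA.
rewrite -(cvg_lim _ (@cvg_mul_mexp Q i j t))//; apply/esym/cvg_lim => //.
rewrite mxE (_ : pseries _ _ = fun n => \sum_l pseries (coef 1%:M i l) t n * Q l j).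
  apply: cvg_sum_ord => l; apply: cvgM; last exact: cvg_cst.
  by have := @cvg_mul_mexp 1%:M i l t; rewrite mul1mx.
apply/funext => n; rewrite /pseries/= /series/=.
under [RHS]eq_bigr do rewrite mulr_suml.
rewrite exchange_big/=; apply: eq_bigr => k _; rewrite /coef -AkQ mxE mulr_sumr mulr_suml.
by apply: eq_bigr => l _; rewrite mul1mx; ring.
Qed.

Lemma mexp0 : mexp (0 *: A) = 1%:M.
Proof.
apply/matrixP => i j; rewrite -[mexp _]mul1mx; apply/esym.
rewrite -(cvg_lim _ (@cvg_mul_mexp 1%:M i j 0))//.
(* Dropping the empty partial sum, which alone misses the constant term, leaves a constant
   sequence. *)
apply/esym/cvg_lim => //; rewrite -(cvg_shiftn 1%N).
rewrite (_ : (fun n => _) = fun=> (1%:M : 'M[R]_m) i j); first exact: cvg_cst.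
apply/funext => n /=; rewrite addn1 /pseries/= /series/= big_nat_recl//.
rewrite big1 => [|k _]; last by rewrite expr0n mulr0.
by rewrite /coef fact0 invr1 mul1r expr0 mulmx1 expr0 mulr1 addr0.
Qed.

Lemma is_derive_mexp i j t :
  is_derive t 1 (fun s => mexp (s *: A) i j) ((A *m mexp (t *: A)) i j).
Proof.
have := is_derive_mul_mexp 1%:M i j t.
by rewrite mul1mx; under eq_fun do rewrite mul1mx.
Qed.

(** The product of [mexp (- u *: A)] and [mexp ((u + r) *: A)] has zero derivative in [u], hence
    equals its value at [u = 0]. No product of series is needed. *)
Lemma mexpD s t : mexp ((t + s) *: A) = mexp (t *: A) *m mexp (s *: A).
Proof.
have dN (i l : 'I_m) (u : R) : is_derive u 1 (fun u => mexp (- u *: A) i l)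
    ((- (A *m mexp (- u *: A))) i l).
  rewrite mxE -[- (_ i l)]mulrN1.
  exact: (is_derive1_comp (is_derive_mexp i l (- u)) (is_deriveNid u 1)).
have dS (r : R) (l j : 'I_m) (u : R) : is_derive u 1 (fun u => mexp ((u + r) *: A) l j)
    ((A *m mexp ((u + r) *: A)) l j).
  have := is_derive1_comp (f := fun s => mexp (s *: A) l j) (g := shift r)
    (is_derive_mexp l j (u + r)) (is_derive_shift u 1 r).
  by rewrite mulr1.
have mexpNM (r u : R) : mexp (- u *: A) *m mexp ((u + r) *: A) = mexp (r *: A).
  have -> : mexp (r *: A) = mexp (- 0 *: A) *m mexp ((0 + r) *: A).
    by rewrite oppr0 mexp0 mul1mx add0r.
  apply/matrixP => i j.
  apply: (@is_derive_0_is_cst _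
    (fun u => (mexp (- u *: A) *m mexp ((u + r) *: A)) i j)) => v.
  have := is_derive_mulmx_entry (F := fun u => mexp (- u *: A))
    (G := fun u => mexp ((u + r) *: A)) (t := v) (i := i) (j := j) (fun l => dN i l v) (fun l => dS r l j v).
  by rewrite mulNmx mulmxA (mexp_comm (Q := A))// addNr mxE.
rewrite -(mexpNM s (t)).
have := mexpNM 0 (- t); rewrite opprK addr0 mexp0 => E.
by rewrite mulmxA E mul1mx.
Qed.

Lemma is_derive_mexp_col x t :
  is_derive t 1 (fun s => mexp (s *: A) *m x) (A *m mexp (t *: A) *m x).
Proof.
apply/is_derive_colP => i.
have := is_derive_mulmx_entry (F := fun u => mexp (u *: A)) (G := fun=> x) (dG := 0)
  (j := 0) (fun l => is_derive_mexp i l t).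
rewrite mulmx0 addr0; apply => l; rewrite mxE; exact: is_derive_cst.
Qed.

End MatrixExponential.

(** * A comparison lemma for functions with one-sided increments *)

Section Gronwall.
Set Implicit Arguments. Unset Strict Implicit.
Variable R : realType.
Implicit Types a b t s e : R.

(** Combines [1 + x <= expR x] with the identity [(1 - x + x^2) (1 + x) = 1 + x^3]. A quadratic
    error disappears in a Dini derivative. *)
Lemma expRN_quad (x : R) : 0 <= x -> expR (- x) <= 1 - x + x ^+ 2.
Proof.
move=> x0; rewrite expRN -[leLHS]mul1r ler_pdivrMr ?expR_gt0//.
apply: (@le_trans _ _ ((1 - x + x ^+ 2) * (1 + x))); last first.
  rewrite ler_wpM2l ?expR_ge1Dx//.
  have := sqr_ge0 (x - 1); rewrite sqrrB1; nra.
have : 0 <= x ^+ 3 by exact: exprn_ge0.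
rewrite (_ : x ^+ 3 = x * x * x); last by rewrite !exprS expr0; ring.
rewrite expr2; nra.
Qed.

(* Only one-sided (Dini) increments of [v] are controlled, so [v] may be a
   Lyapunov function that is not differentiable. *)
Lemma dini_gronwall (v : R -> R) a b kappa c M :
  a <= b -> 0 < kappa -> 0 <= c -> 0 <= M -> v a <= M ->
  (forall e, 0 < e -> exists2 dl, 0 < dl &
     forall s, a < s -> s < a + dl -> s <= b -> v s <= v a + e) ->
  (forall t, a < t -> t < b -> forall e, 0 < e -> exists2 dl, 0 < dl &
     forall s, t < s -> s < t + dl -> s <= b ->
       v s <= v t + (s - t) * (c - kappa * v t + e)) ->
  (forall t, a < t -> t <= b -> forall e, 0 < e -> exists2 dl, 0 < dl &
     forall s, a < s -> s < t -> t - dl < s -> v t <= v s + e) ->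
  v b <= M * expR (- kappa * (b - a)) + c / kappa.
Proof.
move=> ab k0 c0 M0 vaM H0 H1 H2.
(* [z] solves [z' = c - kappa * z] and starts above [v a]. As it is convex, it lies above its
   tangents, which is [zstep]. *)
pose z t := M * expR (- kappa * (t - a)) + c / kappa.
have ck0 : 0 <= c / kappa by rewrite divr_ge0// ltW.
have zge0 t : 0 <= z t by rewrite addr_ge0// mulr_ge0// expR_ge0.
have zstep t s : t <= s -> z t + (s - t) * (c - kappa * z t) <= z s.
  move=> ts; rewrite /z.
  have -> : expR (- kappa * (s - a)) = expR (- kappa * (t - a)) * expR (- kappa * (s - t)).
    by rewrite -expRD; congr expR; ring.
  have E := expR_ge1Dx (- kappa * (s - t)).
  have P : 0 <= M * expR (- kappa * (t - a)) by rewrite mulr_ge0// expR_ge0.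
  have -> : c - kappa * (M * expR (- kappa * (t - a)) + c / kappa) =
      - kappa * (M * expR (- kappa * (t - a))).
    by field; rewrite gt_eqF.
  have := ler_wpM2l P E; rewrite [M * (_ * _)]mulrA.
  by set Q := M * _; set W := expR _; lra.
have za : z a = M + c / kappa by rewrite /z subrr mulr0 expR0 mulr1.
have zle t : a <= t -> z t <= z a.
  move=> at_; rewrite za /z lerD2r ler_piMr// expR_le1 mulNr oppr_le0.
  by rewrite mulr_ge0 ?subr_ge0// ltW.
apply/ler_addgt0Pr => e' e'0.
have ba0 : 0 < 1 + (b - a) by rewrite ltr_pwDl// subr_ge0.
have [e e0 eE] : exists2 e, 0 < e & e * (1 + (b - a)) = e'.
  by exists (e' / (1 + (b - a))); [rewrite divr_gt0|rewrite divfK ?gt_eqF].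
(* Continuous induction on [[a, b]]. In the slack, the constant [e] absorbs the increment of [v]
   just after [a], and [e * (t - a)] absorbs the error [e] per unit time in [H1]. *)
pose S := [set t | [/\ a <= t, t <= b & v t <= z t + e * (1 + (t - a))]].
suff [_ _] : S b by rewrite eE.
have Sa : S a.
  split => //; rewrite za subrr addr0 mulr1. lra.
have Sub : ubound S b by move=> t [].
have Ss : has_sup S by split; [exists a|exists b].
pose t := sup S.
have at_ : a <= t by apply: ub_le_sup => //; exists b.
have tb : t <= b by apply: ge_sup => //; exists a.
(* The supremum belongs to [S] because [H2] forbids an upward jump of [v] at [t] when approached
   from the left. *)
have St : S t.
  move: at_; rewrite le_eqVlt => /predU1P[<-//|at_].
  split => //; first exact: ltW.
  apply/ler_addgt0Pr => d d0.
  have [dl dl0 Hd] := H2 t at_ tb (d / 2) (divr_gt0 d0 (ltr0Sn _ _)).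
  have kz0 : 0 < 2 * (kappa * z a + 1).
    by rewrite mulr_gt0// ltr_wpDl// mulr_ge0// ltW.
  have dl'0 : 0 < Num.min (Num.min dl (t - a)) (d / (2 * (kappa * z a + 1))).
    by rewrite !lt_min dl0 subr_gt0 at_ divr_gt0.
  have [s [as_ sb vs]] := sup_adherent dl'0 Ss.
  rewrite -/t => ts.
  have st : s <= t by apply: ub_le_sup => //; exists b.
  move: st; rewrite le_eqVlt => /predU1P[<-|st]; first by apply: le_trans vs _; rewrite lerDl ltW.
  have ts' : t - s < Num.min (Num.min dl (t - a)) (d / (2 * (kappa * z a + 1))) by lra.
  move: ts'; rewrite !lt_min => /andP[/andP[h1 h2] h3].
  have := Hd s ltac:(lra) st ltac:(lra).
  have := zstep s t (ltW st); have zs := zle s as_.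
  move: h3; rewrite ltr_pdivlMr// => h3.
  have k1 : kappa * z s <= kappa * z a by rewrite ler_pM2l.
  have k2 : (t - s) * (kappa * z s) <= (t - s) * (kappa * z a).
    by rewrite ler_wpM2l// subr_ge0 ltW.
  have k3 : 0 <= (t - s) * c by rewrite mulr_ge0// subr_ge0 ltW.
  have k4 : e * (1 + (s - a)) <= e * (1 + (t - a)) by rewrite ler_pM2l//; lra.
  rewrite mulrBr; lra.
move: tb; rewrite le_eqVlt => /predU1P[<-//|tb].
have tub s : t < s -> S s -> False.
  by move=> ts /(ub_le_sup (ex_intro _ b Sub)); rewrite -/t; lra.
exfalso; move: (at_); rewrite le_eqVlt => /predU1P[ta|lat].
  have [dl dl0 Hd] := H0 (e / 2) (divr_gt0 e0 (ltr0Sn _ _)).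
  have kz0 : 0 < 2 * (kappa * z a + 1).
    by rewrite mulr_gt0// ltr_wpDl// mulr_ge0// ltW.
  pose h := Num.min (Num.min (dl / 2) (b - a)) (e / (2 * (kappa * z a + 1))).
  have h0 : 0 < h by rewrite /h !lt_min divr_gt0// divr_gt0// andbT subr_gt0 ta tb.
  have : h <= h by []; rewrite {2}/h !le_min => /andP[/andP[h1 h2] h3].
  have := Hd (a + h) ltac:(lra) ltac:(lra) ltac:(lra).
  have := zstep a (a + h) ltac:(lra).
  move: h3; rewrite ler_pdivlMr// => h3.
  have -> : a + h - a = h by ring.
  move=> zz vv; apply: (tub (a + h)); first by rewrite -ta; lra.
  split; [lra|lra|].
  have -> : a + h - a = h by ring.
  have k3 : 0 <= h * c by rewrite mulr_ge0// ltW.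
  have k4 : 0 <= e * h by rewrite mulr_ge0// ltW.
  rewrite mulrBr in zz; rewrite mulrDr mulr1; lra.
have [dl dl0 Hd] := H1 t lat tb e e0.
(* [h <= kappa^-1] makes [v + h * (c - kappa * v)] nondecreasing in [v], so the upper bound for
   [v t] may be inserted. *)
pose h := Num.min (Num.min (dl / 2) (b - t)) kappa^-1.
have h0 : 0 < h by rewrite /h !lt_min divr_gt0// invr_gt0 k0 andbT subr_gt0 tb.
have : h <= h by []; rewrite {2}/h !le_min => /andP[/andP[h1 h2] h3].
have := Hd (t + h) ltac:(lra) ltac:(lra) ltac:(lra).
have := zstep t (t + h) ltac:(lra).
have -> : t + h - t = h by ring.
move=> zz vv; apply: (tub (t + h)); first by lra.
split; [lra|lra|].
have hk : 0 <= 1 - kappa * h by rewrite subr_ge0 mulrC -ler_pdivlMr// div1r.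
have [_ _ vt] := St.
have := ler_wpM2l hk vt.
have k4 : 0 <= (kappa * h) * (e * (1 + (t - a))).
  by rewrite !mulr_ge0// ?ltW//; lra.
move: zz vv k4; lra.
Qed.

End Gronwall.

(** * The adapted norm and its decay along perturbed linear motion *)

Section Lyapunov.
Set Implicit Arguments. Unset Strict Implicit.
Variables (R : realType) (m : nat) (A C : 'M[R]_m) (theta : int -> R) (N lambda : R).
Implicit Types (x y : 'cV[R]_m) (s t a b e : R) (j k : int) (n : nat).
Notation E t := (mexp (t *: A)).

Hypothesis AC : A *m C = C *m A.
Hypothesis theta_le : forall k, theta k <= theta (k + 1).
Hypothesis lambda0 : 0 < lambda.
Hypothesis N0 : 0 < N.
Hypothesis matriciant_le : forall j n s t x,
  theta j <= s -> s <= theta (j + 1) ->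
  theta (j + n%:Z) <= t -> t <= theta (j + n%:Z + 1) -> s <= t ->
  enorm (E (t - s) *m C ^+ n *m x) <= N * expR (- lambda * (t - s)) * enorm x.

(** A pair [(n, t)] is a future time [t] with [n] impulses in between. The pieces are closed at both
    ends, so at an impulse moment the states before and after the impulse both count; [lyap_jump]
    rests on this. *)
Let lyap_set k s x := [set expR (lambda * (q.2 - s)) *
    enorm (E (q.2 - s) *m C ^+ q.1 *m x) | q in
  [set q : nat * R | [/\ s <= q.2, theta (k + q.1%:Z) <= q.2 &
     q.2 <= theta (k + q.1%:Z + 1)]]].

(* The norm of the state [x] at time [s], after the [k]-th and before the
   [k+1]-st impulse, that makes the linear impulsive flow a strict contraction:
   the largest future size of the linear solution, discounted at rate [lambda]. *)
Definition lyap k s x := sup (lyap_set k s x).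

Definition in_piece k s := theta k <= s /\ s <= theta (k + 1).

Lemma lyap_ub k s x n t : in_piece k s -> s <= t ->
  theta (k + n%:Z) <= t -> t <= theta (k + n%:Z + 1) ->
  expR (lambda * (t - s)) * enorm (E (t - s) *m C ^+ n *m x) <= N * enorm x.
Proof.
move=> [ks sk] st nt tn.
rewrite -ler_pdivlMl ?expR_gt0// -expRN -mulNr mulrCA mulrA.
exact: (matriciant_le (j := k)).
Qed.

Let lyap_set_ub k s x : in_piece k s -> has_ubound (lyap_set k s x).
Proof.
move=> ks; exists (N * enorm x) => _ [[n t] /= [st nt tn] <-].
exact: (lyap_ub _ ks).
Qed.

Lemma le_lyap k s x n t : in_piece k s -> s <= t ->
  theta (k + n%:Z) <= t -> t <= theta (k + n%:Z + 1) ->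
  expR (lambda * (t - s)) * enorm (E (t - s) *m C ^+ n *m x) <= lyap k s x.
Proof.
move=> ks st nt tn; apply: ub_le_sup; first exact: lyap_set_ub.
by exists (n, t).
Qed.

Lemma lyap_le k s x M : in_piece k s ->
  (forall n t, s <= t -> theta (k + n%:Z) <= t -> t <= theta (k + n%:Z + 1) ->
   expR (lambda * (t - s)) * enorm (E (t - s) *m C ^+ n *m x) <= M) ->
  lyap k s x <= M.
Proof.
move=> [ks sk] H; apply: ge_sup => [|_ [[n t] /= [st nt tn] <-]]; last exact: H.
exists (expR (lambda * (s - s)) * enorm (E (s - s) *m C ^+ 0 *m x)).
by exists (0%N, s) => //=; rewrite addr0; split.
Qed.

Lemma enorm_le_lyap k s x : in_piece k s -> enorm x <= lyap k s x.
Proof.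
move=> [ks sk]; have := @le_lyap k s x 0%N s (conj ks sk) (lexx _).
by rewrite !addr0 subrr mulr0 expR0 mexp0 expr0 mulmx1 mul1mx mul1r; apply.
Qed.

Lemma lyap_le_enorm k s x : in_piece k s -> lyap k s x <= N * enorm x.
Proof. by move=> ks; apply: lyap_le => // n t; exact: (lyap_ub _ ks). Qed.

Lemma lyap_ge0 k s x : in_piece k s -> 0 <= lyap k s x.
Proof. by move=> ks; apply: le_trans (enorm_le_lyap x ks); exact: enorm_ge0. Qed.

Lemma lyapD k s x y : in_piece k s -> lyap k s (x + y) <= lyap k s x + lyap k s y.
Proof.
move=> ks; apply: lyap_le => // n t st nt tn.
apply: le_trans (lerD (le_lyap x ks st nt tn) (le_lyap y ks st nt tn)).
by rewrite -mulrDr ler_wpM2l ?expR_ge0// mulmxDr enormD.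
Qed.

(** The futures of [E (t - s) *m x] seen from [t] are futures of [x] seen from [s]; only the
    discount changes, by [expR (- lambda * (t - s))]. Moving [C ^+ n] past the exponential uses
    [AC]. *)
Lemma lyap_flow k s t x : in_piece k s -> in_piece k t -> s <= t ->
  lyap k t (E (t - s) *m x) <= expR (- lambda * (t - s)) * lyap k s x.
Proof.
move=> ks kt st; apply: lyap_le => // n u tu nu un.
have -> : E (u - t) *m C ^+ n *m (E (t - s) *m x) = E (u - s) *m C ^+ n *m x.
  have -> : u - s = (u - t) + (t - s) by ring.
  have CE : C ^+ n *m E (t - s) = E (t - s) *m C ^+ n.
    apply/esym/mexp_comm; elim: n {nu un} => [|n IH].
      by rewrite expr0 mulmx1 mul1mx.
    by rewrite [C ^+ n.+1]exprS [C * _]/(C *m _) mulmxA AC -mulmxA IH mulmxA.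
  rewrite (mexpD A (t - s) (u - t)); move: (E (u - t)) (E (t - s)) (C ^+ n) CE => P Q S CE.
  by rewrite -(mulmxA P Q) -CE !mulmxA.
have := le_lyap x ks (le_trans st tu) nu un.
rewrite -(ler_pM2l (expR_gt0 (- lambda * (t - s)))); apply: le_trans.
rewrite mulrA -expRD.
by have -> : - lambda * (t - s) + lambda * (u - s) = lambda * (u - t) by ring.
Qed.

(** A future with [n] impulses after the jump is a future with [n + 1] impulses before it, under the
    same discount. *)
Lemma lyap_jump k x :
  lyap (k + 1) (theta (k + 1)) (C *m x) <= lyap k (theta (k + 1)) x.
Proof.
apply: lyap_le; first by split.
move=> n t st nt tn.
have ks : in_piece k (theta (k + 1)) by split.
have kn : k + n.+1%:Z = k + 1 + n%:Z by rewrite intS addrA.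
have := @le_lyap k _ x n.+1 t ks st.
rewrite kn => /(_ nt tn); rewrite exprSr [_ * C]/(_ *m C) mulmxA.
by rewrite -!mulmxA.
Qed.

(** [psi t] is split into the linear flow of [psi s], which contracts with constant one, and a
    remainder, which alone is charged the factor [N]. *)
Lemma lyap_perturb k (psi : R -> 'cV[R]_m) s t :
  in_piece k s -> in_piece k t -> s <= t ->
  lyap k t (psi t) <= expR (- lambda * (t - s)) * lyap k s (psi s) +
    N * enorm (psi t - E (t - s) *m psi s).
Proof.
move=> ks kt st; rewrite -{1}(subrK (E (t - s) *m psi s) (psi t)) addrC.
apply: le_trans (lyapD _ _ kt) _.
by apply: lerD; [exact: lyap_flow|exact: lyap_le_enorm].
Qed.

Lemma enorm_mexp_piece k s t x : in_piece k s -> in_piece k t -> s <= t ->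
  enorm (E (t - s) *m x) <= N * enorm x.
Proof.
move=> [s1 s2] [t1 t2] st.
have := @matriciant_le k 0%N s t x s1 s2; rewrite addr0 expr0 mulmx1.
move=> /(_ t1 t2 st) h; apply: le_trans h _.
rewrite ler_wpM2r ?enorm_ge0// ger_pMr// expR_le1 mulNr oppr_le0.
by rewrite mulr_ge0 ?subr_ge0// ltW.
Qed.

Let mexp_near0 x e : 0 < e -> exists2 dl, 0 < dl & forall h, 0 <= h -> h < dl ->
  enorm (E h *m x - x) <= e.
Proof.
move=> e0; have := is_derive_continuous (is_derive_mexp_col A x 0).
move=> /continuous_enorm /(_ _ e0) [dl dl0 Hd]; exists dl => // h h0 hd.
have := Hd h; rewrite subr0 mexp0 mul1mx; apply.
by rewrite ger0_norm.
Qed.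

(** The comparison lemma applied to the adapted norm of [psi]: over a short time [h] the remainder
    is about [h * (Lf * enorm (psi t) + c)], and [enorm] is dominated by [lyap], so the rate drops
    from [lambda] to [lambda - N * Lf]. *)
Lemma lyap_interval Lf c k a b (psi dpsi : R -> 'cV[R]_m) :
  0 <= Lf -> 0 < lambda - N * Lf -> 0 <= c ->
  theta k <= a -> a < b -> b <= theta (k + 1) ->
  psi @ at_right a --> psi a -> psi @ at_left b --> psi b ->
  (forall t, a < t -> t < b -> is_derive t 1 psi (dpsi t) /\
     enorm (dpsi t - A *m psi t) <= Lf * enorm (psi t) + c) ->
  lyap k b (psi b) <= lyap k a (psi a) * expR (- (lambda - N * Lf) * (b - a)) +
    N * c / (lambda - N * Lf).
Proof.
move=> Lf0 k0 c0 ka ab bk cva cvb D.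
have pc s : a <= s -> s <= b -> in_piece k s by move=> h1 h2; split; lra.
have pa : in_piece k a by apply: pc => //; exact: ltW.
have le1 s t x : in_piece k s -> s <= t -> expR (- lambda * (t - s)) * lyap k s x <= lyap k s x.
  move=> ks st; rewrite ler_piMl ?lyap_ge0// expR_le1 mulNr oppr_le0.
  by rewrite mulr_ge0 ?subr_ge0// ltW.
apply: (@dini_gronwall _ (fun s => lyap k s (psi s)) a b (lambda - N * Lf) (N * c)
  (lyap k a (psi a))) => //; first exact: ltW.
- by rewrite mulr_ge0// ltW.
- exact: lyap_ge0.
- move=> e e0.
  have e'0 : 0 < e / (2 * N) by rewrite divr_gt0// mulr_gt0.
  have [d1 d10 H1] := (at_right_enormP _ _ _).1 cva _ e'0.
  have [d2 d20 H2] := mexp_near0 (psi a) e'0.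
  exists (Num.min d1 d2); first by rewrite lt_min d10.
  move=> s as_ sd sb.
  have : s - a < Num.min d1 d2 by lra.
  rewrite lt_min => /andP[sd1 sd2].
  have ps : in_piece k s by apply: pc => //; exact: ltW.
  apply: le_trans (lyap_perturb psi pa ps (ltW as_)) _.
  apply: lerD; first by apply: le1 => //; exact: ltW.
  have := enorm_triangle (psi a) (psi s) (E (s - a) *m psi a).
  have := H1 s as_ ltac:(lra); have := H2 (s - a) ltac:(lra) sd2.
  rewrite [enorm (_ - psi a)]enormBC => h2 h1 h3.
  rewrite mulrC -ler_pdivlMr//; apply: le_trans h3 _.
  apply: le_trans (lerD h1 h2) _; rewrite le_eqVlt; apply/orP; left; apply/eqP.
  by field; rewrite gt_eqF.
- move=> t at_ tb e e0.
  have [Dt Et] := D t at_ tb.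
  have pt : in_piece k t by apply: pc; exact: ltW.
  (* Two first-order errors [e / (4 * N)] per unit time, multiplied by [N], use up [e / 2]; the
     other half pays for the quadratic remainder of the exponential. *)
  have e'0 : 0 < e / (4 * N) by rewrite divr_gt0// mulr_gt0.
  have [d1 d10 H1] := is_derive_enorm Dt e'0.
  have [d2 d20 H2] := is_derive_enorm (is_derive_mexp_col A (psi t) 0) e'0.
  have Vt0 := lyap_ge0 (psi t) pt.
  have q0 : 0 < lambda ^+ 2 * lyap k t (psi t) + 1 by rewrite ltr_wpDl// mulr_ge0// sqr_ge0.
  have d30 : 0 < (e / 2) / (lambda ^+ 2 * lyap k t (psi t) + 1).
    by rewrite !divr_gt0.
  exists (Num.min (Num.min d1 d2) ((e / 2) / (lambda ^+ 2 * lyap k t (psi t) + 1))).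
    by rewrite !lt_min d10 d20.
  move=> s ts sd sb.
  have : s - t < Num.min (Num.min d1 d2) ((e / 2) / (lambda ^+ 2 * lyap k t (psi t) + 1)) by lra.
  rewrite !lt_min => /andP[/andP[sd1 sd2]]; rewrite ltr_pdivlMr// => sd3.
  have ps : in_piece k s by apply: pc => //; lra.
  have h0 : 0 < s - t by rewrite subr_gt0.
  apply: le_trans (lyap_perturb psi pt ps (ltW ts)) _.
  have := H1 (s - t); have := H2 (s - t).
  rewrite add0r mexp0 mul1mx mulmx1 (gtr0_norm h0) => /(_ sd2) h2 /(_ sd1).
  rewrite [t + _]addrC subrK => h1.
  have h3 : enorm (psi s - E (s - t) *m psi t) <= (s - t) * (e / (2 * N)) +
      (s - t) * (Lf * enorm (psi t) + c).
    have -> : psi s - E (s - t) *m psi t =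
       (psi s - psi t - (s - t) *: dpsi t) + ((s - t) *: (dpsi t - A *m psi t)
       - (E (s - t) *m psi t - psi t - (s - t) *: (A *m psi t))).
      rewrite scalerBr; set u := _ *: _; set v := _ *: _.
      by apply/matrixP => i j; rewrite !mxE; ring.
    apply: le_trans (enormD _ _) _.
    have h4 : enorm ((s - t) *: (dpsi t - A *m psi t)) <= (s - t) * (Lf * enorm (psi t) + c).
      by rewrite enormZ gtr0_norm// ler_pM2l.
    have := le_trans (enormB _ _) (lerD h4 h2).
    have -> : (s - t) * (e / (2 * N)) = (e / (4 * N)) * (s - t) + (e / (4 * N)) * (s - t).
      by field; rewrite gt_eqF.
    lra.
  have h5 : N * enorm (psi s - E (s - t) *m psi t) <= (s - t) * (e / 2) +
      (s - t) * (N * Lf * lyap k t (psi t) + N * c).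
    have h6 : Lf * enorm (psi t) <= Lf * lyap k t (psi t).
      by rewrite ler_wpM2l// enorm_le_lyap.
    apply: le_trans (ler_wpM2l (ltW N0) h3) _.
    have -> : (s - t) * (e / 2) = N * ((s - t) * (e / (2 * N))).
      by field; rewrite gt_eqF.
    have -> : (s - t) * (N * Lf * lyap k t (psi t) + N * c) =
      N * ((s - t) * (Lf * lyap k t (psi t) + c)) by ring.
    by rewrite -[leRHS]mulrDr (ler_pM2l N0) lerD2l (ler_pM2l h0) lerD2r.
  have h7 : expR (- lambda * (s - t)) * lyap k t (psi t) <=
      (1 - lambda * (s - t) + (lambda * (s - t)) ^+ 2) * lyap k t (psi t).
    rewrite ler_wpM2r// mulNr expRN_quad//; by rewrite mulr_ge0// ltW.
  have h8 : (s - t) * ((s - t) * (lambda ^+ 2 * lyap k t (psi t))) <= (s - t) * (e / 2).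
    rewrite ler_pM2l//; lra.
  move: h5 h7 h8; set V := lyap _ _ _; rewrite exprMn; lra.
- move=> t at_ tb e e0.
  have pt : in_piece k t by apply: pc => //; exact: ltW.
  have lt_cv : psi @ at_left t --> psi t.
    move: tb; rewrite le_eqVlt => /predU1P[->//|tb].
    by apply/cvg_at_left_filter/(is_derive_continuous (D t at_ tb).1).
  have e'0 : 0 < e / (N * (3 + N)) by rewrite divr_gt0// mulr_gt0// addr_gt0.
  have [d1 d10 H1] := (at_left_enormP _ _ _).1 lt_cv _ e'0.
  have [d2 d20 H2] := mexp_near0 (psi t) e'0.
  exists (Num.min d1 d2); first by rewrite lt_min d10.
  move=> s as_ st sd.
  have : t - s < Num.min d1 d2 by lra.
  rewrite lt_min => /andP[sd1 sd2].
  have ps : in_piece k s by apply: pc => //; lra.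
  apply: le_trans (lyap_perturb psi ps pt (ltW st)) _.
  apply: lerD; first by apply: le1 => //; exact: ltW.
  have h1 := H1 s st ltac:(lra); have h2 := H2 (t - s) ltac:(lra) sd2.
  have h3 := enorm_mexp_piece (psi s - psi t) ps pt (ltW st).
  have h4 : enorm (psi t - E (t - s) *m psi s) <= enorm (E (t - s) *m psi t - psi t) +
     enorm (E (t - s) *m (psi s - psi t)).
    rewrite [enorm (_ - psi t)]enormBC.
    have -> : psi t - E (t - s) *m psi s = (psi t - E (t - s) *m psi t) -
      E (t - s) *m (psi s - psi t).
      by rewrite mulmxBr opprB addrA subrK.
    exact: enormB.
  have h5 : N * enorm (psi s - psi t) <= N * (e / (N * (3 + N))) by rewrite ler_pM2l.
  have h6 : enorm (psi t - E (t - s) *m psi s) <= (3 + N) * (e / (N * (3 + N))) by lra.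
  apply: le_trans (ler_wpM2l (ltW N0) h6) _; rewrite le_eqVlt; apply/orP; left; apply/eqP.
  by field; rewrite !gt_eqF// addr_gt0.
Qed.

End Lyapunov.

(** * Periodic integer sequences and the pieces cut out by the impulse moments *)

Section PeriodicSequences.
Set Implicit Arguments. Unset Strict Implicit.
Variables (R : realType) (p : nat).
Implicit Types (k j : int) (t : R).

Hypothesis p0 : (0 < p)%N.

Lemma int_periodic (F : int -> R) : (forall k, F (k + p%:Z) = F k) ->
  forall k q, F (k + q * p%:Z) = F k.
Proof.
move=> Fp k q; elim: q k => [k|n IH k|n IH k]; first by rewrite mul0r addr0.
  by rewrite intS mulrDl mul1r addrA IH Fp.
rewrite -(Fp (k + _)) -[RHS]IH; congr F; rewrite intS; ring.
Qed.

Lemma int_periodic_bounded (F : int -> R) : (forall k, F (k + p%:Z) = F k) ->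
  exists2 M, 0 < M & forall k, `|F k| <= M.
Proof.
move=> Fp; exists (\sum_(i < p) `|F i%:Z| + 1) => [|k].
  by rewrite ltr_wpDl// sumr_ge0.
have p1 : (0 < p%:Z)%R by [].
rewrite (divz_eq k p%:Z) addrC int_periodic//.
have : (0 <= (k %% p%:Z)%Z)%R by rewrite modz_ge0// gt_eqF.
have := ltz_pmod k p1; case: (k %% p%:Z)%Z => // i ip _.
rewrite (bigD1 (Ordinal (ip : (i < p)%N)))//= -addrA lerDl addr_ge0//.
by rewrite sumr_ge0.
Qed.

Lemma int_periodic_pos (F : int -> R) : (forall k, F (k + p%:Z) = F k) ->
  (forall k, 0 < F k) -> exists2 M, 0 < M & forall k, M <= F k.
Proof.
move=> Fp F0; have [|M M0 HM] := @int_periodic_bounded (fun k => (F k)^-1).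
  by move=> k; rewrite Fp.
exists M^-1; first by rewrite invr_gt0.
move=> k; rewrite -[leRHS]invrK lef_pV2 ?posrE ?invr_gt0//.
by apply: le_trans (HM k); rewrite ler_norm.
Qed.

Variables (omega : R) (theta : int -> R).
Hypothesis omega0 : 0 < omega.
Hypothesis theta_lt : forall k1 k2, (k1 < k2)%R -> theta k1 < theta k2.
Hypothesis theta_per : forall k, theta (k + p%:Z)%R = theta k + omega.

Lemma theta_le k1 k2 : (k1 <= k2)%R -> theta k1 <= theta k2.
Proof. by rewrite le_eqVlt => /predU1P[->//|/theta_lt/ltW]. Qed.

Lemma theta_ltE k1 k2 : (theta k1 < theta k2) = (k1 < k2)%R.
Proof.
apply/idP/idP => [h|/theta_lt//]; rewrite ltNge; apply/negP => /theta_le; lra.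
Qed.

Lemma theta_ltS k : theta k < theta (k + 1).
Proof. by apply: theta_lt; rewrite ltrDl. Qed.

Lemma theta_shift k q : theta (k + q * p%:Z) = theta k + q%:~R * omega.
Proof.
elim: q k => [k|n IH k|n IH k]; first by rewrite !mul0r !addr0.
  by rewrite intS mulrDl mul1r addrA IH theta_per intrD; ring.
apply: (@addIr _ omega); rewrite -theta_per.
have -> : k + - n.+1%:Z * p%:Z + p%:Z = k + - n%:Z * p%:Z by rewrite intS; ring.
rewrite IH intS !intrN intrD; ring.
Qed.

Lemma piece_of t : exists k, theta k < t <= theta (k + 1).
Proof.
(* The ceiling minus one, not the floor, because pieces are open on the left and closed on the
   right. [q] is the period containing [t]; minimality then selects the piece in it. *)
pose q := Num.ceil ((t - theta 0) / omega) - 1.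
have [q1 q2] : theta (q * p%:Z) < t /\ t <= theta (q * p%:Z + p%:Z).
  rewrite -[q * _]add0r theta_per theta_shift.
  have /andP[] := ceil_itv ((t - theta 0) / omega).
  have -> : Num.ceil ((t - theta 0) / omega) = q + 1 by rewrite /q subrK.
  rewrite addrK intrD ltr_pdivlMr// ler_pdivrMr// mulrDl mul1r => q1 q2.
  by split; lra.
have [j tj jmin] := ex_minnP (ex_intro (fun n : nat => t <= theta (q * p%:Z + n%:Z)) p q2).
case: j tj jmin => [|j] tj jmin; first by move: tj; rewrite addr0; lra.
exists (q * p%:Z + j%:Z); rewrite -addrA [j%:Z + 1]addrC -intS tj andbT ltNge.
by apply/negP => /jmin; rewrite ltnn.
Qed.

Lemma piece_inj k j t : theta k < t <= theta (k + 1) ->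
  theta j < t <= theta (j + 1) -> k = j.
Proof.
move=> /andP[k1 k2] /andP[j1 j2].
have : theta k < theta (j + 1) by apply: lt_le_trans j2.
have : theta j < theta (k + 1) by apply: lt_le_trans k2.
by rewrite !theta_ltE; clear; lia.
Qed.

End PeriodicSequences.

(** * The bound on the matriciant, extended to closed pieces *)

Section Matriciant.
Set Implicit Arguments. Unset Strict Implicit.
Variables (R : realType) (m : nat) (A C : 'M[R]_m) (theta : int -> R) (N lambda : R).
Hypothesis theta_lt : forall k1 k2, (k1 < k2)%R -> theta k1 < theta k2.
Hypothesis opnorm_le : forall (s t : R) (n : nat), s <= t -> icount theta s t n ->
  opnorm (mexp ((t - s) *: A) *m C ^+ n) <= N * expR (- lambda * (t - s)).

(* The hypothesis gives the bound for [theta j < s] and [theta (j + n) < t];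
   the closed ends, where the impulse at [s] or [t] has already occurred,
   follow by continuity. *)
Lemma matriciant_bound (j : int) (n : nat) (s t : R) (x : 'cV[R]_m) :
  theta j <= s -> s <= theta (j + 1) ->
  theta (j + n%:Z) <= t -> t <= theta (j + n%:Z + 1) -> s <= t ->
  enorm (mexp ((t - s) *: A) *m C ^+ n *m x) <= N * expR (- lambda * (t - s)) * enorm x.
Proof.
move=> js sj nt tn st.
have thle : forall k1 k2, (k1 <= k2)%R -> theta k1 <= theta k2.
  by move=> k1 k2; rewrite le_eqVlt => /predU1P[->//|/theta_lt/ltW].
have inside s' t' : theta j < s' -> s' <= theta (j + 1) ->
    theta (j + n%:Z) < t' -> t' <= theta (j + n%:Z + 1) -> s' <= t' ->
    enorm (mexp ((t' - s') *: A) *m C ^+ n *m x) <= N * expR (- lambda * (t' - s')) * enorm x.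
  move=> h1 h2 h3 h4 h5; apply: le_trans (opnormP _ _) _.
  rewrite ler_wpM2r ?enorm_ge0//; apply: opnorm_le => //.
  (* With [s'] in piece [j] and [t'] in piece [j + n], the impulses in [[s', t')] have exactly the
     indices [j + 1] to [j + n]. *)
  exists (j + 1) => k; split=> -[k1 k2].
    split; [rewrite leNgt|rewrite ltNge]; apply/negP => h.
      by have : theta k <= theta j by [apply: thle; rewrite -ltzD1]; lra.
    by have : theta (j + n%:Z + 1) <= theta k by [apply: thle; rewrite addrAC]; lra.
  split; first by apply: le_trans h2 _; apply: thle.
  by apply: le_lt_trans h3; apply: thle; rewrite -ltzD1 addrAC.
pose D := (theta (j + n%:Z + 1) - t) - (theta (j + 1) - s).
(* The elapsed time after [s] and [t] have both moved the fraction [r] of the way to the right ends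
   of their pieces; for [r > 0] both have left the left ends. *)
pose u r := (t - s) + r * D.
have near r : 0 < r -> r <= 1 ->
    enorm (mexp (u r *: A) *m (C ^+ n *m x)) <= N * expR (- lambda * u r) * enorm x.
  move=> r0 r1; have j1 : theta j < theta (j + 1) by apply: theta_lt; rewrite ltrDl.
  have n1 : theta (j + n%:Z) < theta (j + n%:Z + 1) by apply: theta_lt; rewrite ltrDl.
  have jn : theta (j + 1) <= theta (j + n%:Z + 1) by apply: thle; rewrite lerD2r lerDl.
  have -> : u r = (t + r * (theta (j + n%:Z + 1) - t)) - (s + r * (theta (j + 1) - s)).
    by rewrite /u /D; ring.
  rewrite mulmxA; apply: inside; nra.
apply/ler_addgt0Pr => e e0; have e20 : 0 < e / 2 by rewrite divr_gt0.
have [d1 d10 H1] := continuous_enorm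
  (is_derive_continuous (is_derive_mexp_col A (C ^+ n *m x) (t - s))) e20.
have cq : {for t - s, continuous (fun r => N * expR (- lambda * r) * enorm x)}.
  apply: cvgM; last exact: cvg_cst.
  apply: cvgM; first exact: cvg_cst.
  apply: continuous_comp; last exact: continuous_expR.
  by apply: cvgM; [exact: cvg_cst|exact: cvg_id].
move/cvgrPdist_le : cq => /(_ _ e20)[d2 /= d20 H2].
pose r := Num.min 1 (Num.min (d1 / (2 * (`|D| + 1))) (d2 / (2 * (`|D| + 1)))).
have tri (P Q : 'cV[R]_m) (b1 b2 : R) : enorm (P - Q) <= e / 2 -> enorm P <= b1 ->
    - (e / 2) <= b2 - b1 -> enorm Q <= b2 + e.
  by have := enorm_triangle P Q 0; rewrite !subr0 enormBC; lra.
have D1 : 0 < 2 * (`|D| + 1) by rewrite mulr_gt0// ltr_wpDl.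
have r0 : 0 < r by rewrite /r !lt_min !divr_gt0// ltr01.
have : r <= r by []; rewrite {2}/r !le_min => /and3P[r1].
rewrite !ler_pdivlMr// => rd1 rd2.
have rD : `|u r - (t - s)| = r * `|D|.
  by rewrite /u addrC addKr normrM gtr0_norm.
have h1 := H1 (u r).
have h2 : `|u r - (t - s)| < d2 -> `|N * expR (- lambda * (t - s)) * enorm x -
    N * expR (- lambda * u r) * enorm x| <= e / 2 by rewrite distrC; exact: H2.
rewrite rD in h2; rewrite rD in h1.
have := near r r0 r1; have {}h1 := h1 ltac:(lra); have {}h2 := h2 ltac:(lra).
move: h2; rewrite ler_norml => /andP[h2 h3] h4.
rewrite -mulmxA; exact: tri h1 h4 h2.
Qed.

End Matriciant.

(** * Contraction from one impulse moment to the next *)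

Section Contraction.
Set Implicit Arguments. Unset Strict Implicit.
Variables (R : realType) (m p : nat) (omega : R) (A C : 'M[R]_m) (theta : int -> R).
Variables (N lambda Lf Lh : R).
Implicit Types (x v : 'cV[R]_m) (psi : R -> 'cV[R]_m) (a b c s t : R) (k : int).

(** Covers both a difference of two solutions, with [c] the difference of forcing, and a single
    bounded-forcing solution, with [c] the bound on everything but the linear part. [psi a] stands
    for the state after the impulse. *)
Definition quasi_linear c a b psi :=
  [/\ psi @ at_right a --> psi a, psi @ at_left b --> psi b &
      forall t, a < t -> t < b -> exists2 d, is_derive t 1 psi d &
        enorm (d - A *m psi t) <= Lf * enorm (psi t) + c].

Lemma quasi_linearS c a b t psi : a < t -> t <= b ->
  quasi_linear c a b psi -> quasi_linear c a t psi.
Proof.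
move=> at_ + [ca cb D]; rewrite le_eqVlt => /predU1P[->|tb]; first by split.
split; [exact: ca| |by move=> s as_ st; apply: D as_ (lt_trans st tb)].
have [d Dd _] := D t at_ tb.
exact/cvg_at_left_filter/(is_derive_continuous Dd).
Qed.

Hypothesis omega0 : 0 < omega.
Hypothesis p0 : (0 < p)%N.
Hypothesis theta_lt : forall k1 k2, (k1 < k2)%R -> theta k1 < theta k2.
Hypothesis theta_per : forall k, theta (k + p%:Z)%R = theta k + omega.
Hypothesis AC : A *m C = C *m A.
Hypotheses (N0 : 0 < N) (lambda0 : 0 < lambda) (Lf0 : 0 < Lf) (Lh0 : 0 < Lh).
Hypothesis opnorm_le : forall (s t : R) (n : nat), s <= t -> icount theta s t n ->
  opnorm (mexp ((t - s) *: A) *m C ^+ n) <= N * expR (- lambda * (t - s)).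
Hypothesis A6 : N * Lf + p%:R / omega * ln (1 + N * Lh) < lambda.

Let V := lyap A C theta lambda.
Let a0 := lambda - N * Lf.
Let cc := ln (1 + N * Lh).
Let kappa := p%:R / omega * cc.
(** [kappa * theta k] counts impulses at their mean density [p / omega], with weight [cc] each,
    while [cc * k] counts them exactly. The difference is [p]-periodic in [k] because
    [kappa * omega = p * cc], hence bounded. *)
Let W k := expR (kappa * theta k - cc * k%:~R).

Let NLh0 : 0 < N * Lh.
Proof. exact: mulr_gt0. Qed.

Let cc0 : 0 < cc.
Proof. by rewrite /cc ln_gt0// ltrDl. Qed.

Let gamma0 : 0 < a0 - kappa.
Proof. by move: A6; rewrite /a0 /kappa /cc; lra. Qed.

Let a00 : 0 < a0.
Proof.
have : 0 <= kappa by rewrite /kappa !mulr_ge0// ?invr_ge0 ltW.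
by have := gamma0; lra.
Qed.

Let thS k : theta k < theta (k + 1).
Proof. exact: theta_ltS. Qed.

Let MB := matriciant_bound theta_lt opnorm_le.

Let thleS k : theta k <= theta (k + 1).
Proof. exact: ltW. Qed.

Let W_per k : W (k + p%:Z) = W k.
Proof.
rewrite /W theta_per intrD; congr expR.
by rewrite /kappa -[p%:Z%:~R]/(p%:R); field; rewrite gt_eqF.
Qed.

Let gap_per k : theta (k + p%:Z + 1) - theta (k + p%:Z) = theta (k + 1) - theta k.
Proof. by rewrite addrAC !theta_per; ring. Qed.

Let lyap_piece c k a t psi : 0 <= c -> theta k <= a -> a < t -> t <= theta (k + 1) ->
  quasi_linear c a t psi ->
  V k t (psi t) <= V k a (psi a) * expR (- a0 * (t - a)) + N * c / a0.
Proof.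
move=> c0 ka at_ tk [ca cb D].
have D' s : a < s -> s < t -> is_derive s 1 psi ('D_1 psi s) /\
    enorm ('D_1 psi s - A *m psi s) <= Lf * enorm (psi s) + c.
  move=> as_ st; have [d Dd] := D s as_ st.
  by have [_ ->] := Dd; split => //; have [Dd1 _] := Dd; exact: derivableP.
exact (lyap_interval AC lambda0 N0 MB (ltW Lf0) a00 c0 ka at_ tk ca cb D').
Qed.

(** Passing to the next weight trades the jump factor for a loss [kappa] in the rate, and
    [a0 - kappa > 0] is (A6). *)
Let W_jump k : W (k + 1) * (1 + N * Lh) * expR (- a0 * (theta (k + 1) - theta k)) =
  W k * expR (- (a0 - kappa) * (theta (k + 1) - theta k)).
Proof.
have -> : 1 + N * Lh = expR cc by rewrite lnK// posrE addr_gt0.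
rewrite /W -!expRD intrD; congr expR; rewrite -[1%:~R]/1; ring.
Qed.

(** The start [a] may lie anywhere in the piece: this serves the intermediate times of a full piece
    as well as initial times that are not impulse moments. *)
Lemma enorm_piece : exists2 K : R, 1 <= K & forall k psi a t c,
  0 <= c -> theta k <= a -> a < theta (k + 1) -> a <= t -> t <= theta (k + 1) ->
  quasi_linear c a (theta (k + 1)) psi -> enorm (psi t) <= K * (enorm (psi a) + c).
Proof.
have Na0 : 0 < N / a0 by rewrite divr_gt0.
exists (1 + N + N / a0) => [|k psi a t c c0 ka ak at_ tk Q]; first by rewrite -addrA lerDl addr_ge0 ?ltW.
have e0 := enorm_ge0 (psi a).
have h1 : 0 <= N * c by rewrite mulr_ge0// ltW.
have h2 : 0 <= N / a0 * enorm (psi a) by rewrite mulr_ge0// ltW.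
have h4 : 0 <= N / a0 * c by rewrite mulr_ge0// ltW.
have h3 : 0 <= N * enorm (psi a) by rewrite mulr_ge0// ltW.
move: at_; rewrite le_eqVlt => /predU1P[<-|at_].
  rewrite !mulrDr !mulrDl; lra.
have pa : in_piece theta k a by split => //; exact: ltW.
have pt : in_piece theta k t by split => //; apply: le_trans ka (ltW at_).
have := lyap_piece c0 ka at_ tk (quasi_linearS at_ tk Q).
have := enorm_le_lyap MB (psi t) pt.
have := lyap_le_enorm MB (psi a) pa.
have : V k a (psi a) * expR (- a0 * (t - a)) <= V k a (psi a).
  rewrite ler_piMr// ?(lyap_ge0 MB)// expR_le1 mulNr oppr_le0.
  by rewrite mulr_ge0 ?(ltW a00)// subr_ge0 (ltW at_).
rewrite -/V (_ : N * c / a0 = N / a0 * c); last by ring.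
rewrite !mulrDr !mulrDl; lra.
Qed.

(* The weight [W] spreads the jump factor [1 + N * Lh] evenly over a period,
   so that (A6) makes every single piece a contraction. *)
Lemma impulsive_contraction : exists nu : int -> 'cV[R]_m -> R, exists rho K : R,
  [/\ [/\ 0 < rho, rho < 1 & 1 <= K],
      (forall k x, enorm x <= K * nu k x),
      (forall k x, nu k x <= K * enorm x),
      (forall k psi v c, 0 <= c -> quasi_linear c (theta k) (theta (k + 1)) psi ->
        enorm (psi (theta k) - C *m v) <= Lh * enorm v + c ->
        nu (k + 1) (psi (theta (k + 1))) <= rho * nu k v + K * c) &
      (forall k psi v c t, 0 <= c -> quasi_linear c (theta k) (theta (k + 1)) psi ->
        enorm (psi (theta k) - C *m v) <= Lh * enorm v + c ->
        theta k <= t -> t <= theta (k + 1) ->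
        enorm (psi t) <= K * (nu k v + c))].
Proof.
have [w2 w20 Hw2] := int_periodic_bounded p0 W_per.
have [w1 w10 Hw1] := int_periodic_pos p0 W_per (fun k => expR_gt0 _).
(* By periodicity the gaps between impulses have a positive lower bound, which makes the contraction
   factor independent of the piece. *)
have [l l0 Hl] := int_periodic_pos p0 gap_per (fun k => ltac:(by rewrite subr_gt0)).
have [K1 K11 HK1] := enorm_piece.
have [KC KC0 HKC] := enorm_mulmx_bound C.
(* The index [k - 1] matters: the state at [theta k] is the one before the impulse, so it is
   measured as the end of the preceding piece. *)
pose nu k x := W k * V (k - 1) (theta k) x.
have pk k : in_piece theta (k - 1) (theta k) by split; [apply: (theta_le theta_lt); rewrite gerBl|rewrite subrK].
have W2 k : W k <= w2 by apply: le_trans (Hw2 k); rewrite ler_norm.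
have W0 k : 0 < W k by exact: expR_gt0.
have nu0 k x : 0 <= nu k x by rewrite mulr_ge0 ?expR_ge0// (lyap_ge0 MB).
have nu1 k x : enorm x <= w1^-1 * nu k x.
  rewrite ler_pdivlMl//; apply: ler_pM; rewrite ?enorm_ge0 ?(ltW w10)//.
  exact: (enorm_le_lyap MB).
have nu2 k x : nu k x <= w2 * N * enorm x.
  rewrite -mulrA; apply: ler_pM; rewrite ?(ltW (W0 k)) ?(lyap_ge0 MB)//.
  exact: (lyap_le_enorm MB).
pose Ks := w2 * (N + N / a0).
pose Kp := K1 * ((KC + Lh) / w1 + 2).
pose K := 1 + w1^-1 + w2 * N + Ks + Kp.
have w1i : 0 < w1^-1 by rewrite invr_gt0.
have w2N : 0 < w2 * N by rewrite mulr_gt0.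
have Ks0 : 0 < Ks by rewrite mulr_gt0// addr_gt0// divr_gt0.
have Kp0 : 0 < Kp.
  by rewrite mulr_gt0//; [lra|rewrite addr_gt0// divr_gt0// addr_gt0].
exists nu, (expR (- (a0 - kappa) * l)), K; split.
- split; [exact: expR_gt0|rewrite expR_lt1 mulNr oppr_lt0 mulr_gt0//|rewrite /K; lra].
- move=> k x; apply: le_trans (nu1 k x) _; rewrite ler_wpM2r// /K; lra.
- move=> k x; apply: le_trans (nu2 k x) _; rewrite ler_wpM2r ?enorm_ge0// /K; lra.
- move=> k psi v c c0 Q J.
  have := lyap_piece c0 (lexx _) (thS k) (lexx _) Q.
  set T := theta (k + 1) - theta k; set ex := expR _ => H.
  have pkk : in_piece theta k (theta k) by split => //; exact: ltW.
  (* By [lyap_jump] the linear part of the impulse does not increase the norm; the deviation, at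
     most [Lh * enorm v + c], is charged [N], whence [1 + N * Lh]. *)
  have H1 : V k (theta k) (psi (theta k)) <= (1 + N * Lh) * V (k - 1) (theta k) v + N * c.
    rewrite -{1}(subrK (C *m v) (psi (theta k))) addrC.
    apply: le_trans (lyapD MB _ _ pkk) _.
    have := lyap_jump thleS MB (k - 1) v; rewrite !subrK => j1.
    have j2 := lyap_le_enorm MB (psi (theta k) - C *m v) pkk.
    have j3 : N * (Lh * enorm v + c) <= N * (Lh * V (k - 1) (theta k) v + c).
      by rewrite ler_pM2l// lerD2r ler_pM2l// (enorm_le_lyap MB).
    have j4 : N * enorm (psi (theta k) - C *m v) <= N * (Lh * enorm v + c).
      by rewrite ler_pM2l.
    move: j1 j2 j3 j4; rewrite -/V; set b1 := V _ _ _; set b2 := V _ _ _; set b3 := V _ _ _.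
    set n1 := enorm _; set n2 := enorm _ => *; lra.
  have ex1 : 0 <= ex by exact: expR_ge0.
  have exle : ex <= 1.
    by rewrite expR_le1 mulNr oppr_le0 mulr_ge0 ?(ltW a00)// subr_ge0 thleS.
  rewrite {1}/nu addrK.
  have Wk := W0 (k + 1).
  apply: le_trans (ler_wpM2l (ltW Wk) H) _.
  apply: (@le_trans _ _ (W (k + 1) * (((1 + N * Lh) * V (k - 1) (theta k) v + N * c) * ex
     + N * c / a0))).
    by rewrite ler_wpM2l ?(ltW Wk)// lerD2r ler_wpM2r.
  have -> : W (k + 1) * (((1 + N * Lh) * V (k - 1) (theta k) v + N * c) * ex + N * c / a0) =
    (W (k + 1) * (1 + N * Lh) * ex) * V (k - 1) (theta k) v +
     W (k + 1) * (N * ex + N / a0) * c by ring.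
  rewrite W_jump; apply: lerD.
    have -> : W k * expR (- (a0 - kappa) * (theta (k + 1) - theta k)) * V (k - 1) (theta k) v =
      expR (- (a0 - kappa) * (theta (k + 1) - theta k)) * nu k v by rewrite /nu; ring.
    rewrite ler_wpM2r// ler_expR !mulNr lerN2 ler_pM2l//.
  rewrite ler_wpM2r//; apply: (@le_trans _ _ Ks); last by rewrite /K; lra.
  have ? : 0 <= N / a0 by rewrite divr_ge0 ?ltW.
  apply: ler_pM; rewrite ?(ltW Wk) ?addr_ge0// ?mulr_ge0 ?(ltW N0)//.
  by rewrite lerD2r ler_piMr// ltW.
- move=> k psi v c t c0 Q J kt tk.
  apply: le_trans (HK1 _ _ _ _ _ c0 (lexx _) (thS k) kt tk Q) _.
  have j1 : enorm (psi (theta k)) <= enorm (psi (theta k) - C *m v) + enorm (C *m v).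
    by have := enormD (psi (theta k) - C *m v) (C *m v); rewrite subrK.
  have j2 := HKC v.
  have j3 : (KC + Lh) * enorm v <= (KC + Lh) * (w1^-1 * nu k v).
    by rewrite ler_wpM2l// addr_ge0// ltW.
  apply: (@le_trans _ _ (Kp * (nu k v + c))); last first.
    rewrite ler_wpM2r ?addr_ge0// /K; lra.
  have j5 : 0 <= (KC + Lh) / w1 * c by rewrite mulr_ge0// divr_ge0 ?ltW// addr_gt0.
  have j6 := nu0 k v.
  rewrite -mulrA ler_wpM2l//; first lra.
  have -> : ((KC + Lh) / w1 + 2) * (nu k v + c) = (KC + Lh) * (w1^-1 * nu k v) +
     (KC + Lh) / w1 * c + 2 * nu k v + 2 * c by ring.
  rewrite mulrDl in j3; lra.
Qed.

End Contraction.

(** * Sequences with geometrically decreasing increments *)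

Section GeometricConvergence.
Set Implicit Arguments. Unset Strict Implicit.
Variable R : realType.

Lemma geometric_small (C e : R) (q : R) : 0 <= q -> q < 1 -> 0 < e ->
  exists n, C * q ^+ n <= e.
Proof.
move=> q0 q1 e0.
have : (fun n => C * q ^+ n) @ \oo --> (0 : R).
  by apply: cvg_geometric; rewrite ger0_norm.
move=> /cvgrPdist_le /(_ _ e0)[n _ H]; exists n.
have := H n (leqnn n); rewrite sub0r normrN; apply: le_trans.
exact: ler_norm.
Qed.

Lemma geometric_increments (u : nat -> R) (q C : R) : 0 <= q -> q < 1 -> 0 <= C ->
  (forall n, `|u n.+1 - u n| <= C * q ^+ n) ->
  exists l, forall n, `|u n - l| <= C / (1 - q) * q ^+ n.
Proof.
move=> q0 q1 C0 H.
(* Keeping the factor [1 - q ^+ k] of the finite geometric sum lets the induction close with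
   equality. *)
have far n k : `|u (n + k)%N - u n| <= C / (1 - q) * q ^+ n * (1 - q ^+ k).
  have q1' : 1 - q != 0 by rewrite subr_eq0 gt_eqF.
  elim: k => [|k IH]; first by rewrite addn0 subrr normr0 expr0 subrr mulr0.
  have := ler_normD (u (n + k.+1)%N - u (n + k)%N) (u (n + k)%N - u n).
  rewrite addrA subrK => h; apply: le_trans h _.
  have := H (n + k)%N; rewrite -addnS => h; apply: le_trans (lerD h IH) _.
  by rewrite le_eqVlt; apply/orP; left; apply/eqP; rewrite exprD exprS; field.
have D0 n : 0 <= C / (1 - q) * q ^+ n.
  by rewrite mulr_ge0 ?exprn_ge0// divr_ge0// subr_ge0 ltW.
have far' n k : `|u (n + k)%N - u n| <= C / (1 - q) * q ^+ n.
  by apply: le_trans (far n k) _; rewrite ler_piMr// gerBl exprn_ge0.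
have : cvgn u.
  apply/cauchy_cvgP/cauchy_ballP => e e0.
  have [n Hn] := geometric_small (C / (1 - q)) q0 q1 (divr_gt0 e0 (ltr0Sn R 2)).
  near_simpl; near=> j k; rewrite /ball/=.
  have jn : (n <= j)%N by near: j; exact: nbhs_infty_ge.
  have kn : (n <= k)%N by near: k; exact: nbhs_infty_ge.
  have := far' n (j - n)%N; have := far' n (k - n)%N; rewrite !subnKC// => h1 h2.
  have := ler_distD (u n) (u j) (u k); rewrite [`|u n - u k|]distrC; lra.
move=> ul; exists (limn u) => n.
apply/ler_addgt0Pr => e e0.
move/cvgrPdist_le : ul => /(_ _ e0)[N _ HN].
have := HN (n + N)%N (leq_addl _ _) => /= h.
have := ler_distD (u (n + N)%N) (u n) (limn u).
have := far' n N; rewrite [`|u n - u (n + N)%N|]distrC.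
by rewrite [`|limn u - _|]distrC in h; lra.
Unshelve. all: by end_near. Qed.

Lemma geometric_increments_col m (u : nat -> 'cV[R]_m) (q C : R) :
  0 <= q -> q < 1 -> 0 <= C -> (forall n, `|u n.+1 - u n| <= C * q ^+ n) ->
  exists l, forall n, `|u n - l| <= C / (1 - q) * q ^+ n.
Proof.
move=> q0 q1 C0 H.
have Hi i : exists l, forall n, `|u n i 0 - l| <= C / (1 - q) * q ^+ n.
  apply: geometric_increments => // n.
  by have := coord_le_norm (u n.+1 - u n) i; rewrite !mxE => /le_trans; apply.
have [l Hl] := choice Hi.
exists (\col_i l i) => n; apply: norm_le_coord => [|i]; last by rewrite !mxE.
by rewrite mulr_ge0 ?exprn_ge0// divr_ge0// subr_ge0 ltW.
Qed.

End GeometricConvergence.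

(** * The mean value inequality and antiderivatives *)

Section GlobalODE.
Set Implicit Arguments. Unset Strict Implicit.
Variables (R : realType) (m : nat).
Implicit Types (a t s : R) (v : 'cV[R]_m).

(** Both [G + D] and [G - D] have nonnegative derivative. *)
Lemma increment_le (D G D' G' : R -> R) a t : a <= t ->
  (forall s, a <= s -> s <= t -> is_derive s 1 D (D' s)) ->
  (forall s, a <= s -> s <= t -> is_derive s 1 G (G' s)) ->
  (forall s, a <= s -> s <= t -> `|D' s| <= G' s) -> `|D t - D a| <= G t - G a.
Proof.
move=> at_ HD HG HDG.
have mono (H H' : R -> R) : (forall s, a <= s -> s <= t -> is_derive s 1 H (H' s)) ->
    (forall s, a <= s -> s <= t -> 0 <= H' s) -> H a <= H t.
  move=> dH H0; have [||c ct E] := @MVT_segment R H H' a t at_.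
  - by move=> s /itvP sa; apply: dH; rewrite sa.
  - apply: derivable_within_continuous => s /itvP sa.
    by have [||] := dH s; rewrite ?sa.
  - rewrite -subr_ge0 E mulr_ge0 ?subr_ge0// H0//; by rewrite (itvP ct).
rewrite ler_norml; apply/andP; split.
  suff : G a + D a <= G t + D t by move=> *; lra.
  apply: (mono (G + D) (fun s => G' s + D' s)) => s as_ st.
    by apply: is_deriveD; [exact: HG|exact: HD].
  by have := HDG s as_ st; rewrite ler_norml => /andP[]; lra.
suff : G a - D a <= G t - D t by move=> *; lra.
apply: (mono (G - D) (fun s => G' s - D' s)) => s as_ st.
  by apply: is_deriveB; [exact: HG|exact: HD].
by have := HDG s as_ st; rewrite ler_norml => /andP[]; lra.
Qed.

Lemma increment_le_col (D : R -> 'cV[R]_m) (D' : R -> 'cV[R]_m) (G G' : R -> R) a t :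
  a <= t -> (forall s, a <= s -> s <= t -> is_derive s 1 D (D' s)) ->
  (forall s, a <= s -> s <= t -> is_derive s 1 G (G' s)) ->
  (forall s, a <= s -> s <= t -> `|D' s| <= G' s) -> `|D t - D a| <= G t - G a.
Proof.
move=> at_ HD HG HDG; apply: norm_le_coord => [|i].
  apply: le_trans (normr_ge0 (G t - G a)) _; apply: (increment_le at_ HG HG) => s as_ st.
  by rewrite ger0_norm//; apply: le_trans (HDG s as_ st).
rewrite !mxE; apply: (@increment_le (fun s => D s i 0) G (fun s => D' s i 0) G') => //.
  by move=> s as_ st; apply: (is_derive_colP _ _ _).1; exact: HD.
by move=> s as_ st; apply: le_trans (HDG s as_ st); exact: coord_le_norm.
Qed.

(** Integration starts at [a - 1] so that the derivative at [a] is two-sided. *)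
Lemma antiderivative (u : R -> R) a : continuous u ->
  exists U : R -> R, U a = 0 /\ forall t, a - 1 < t -> is_derive t 1 U (u t).
Proof.
move=> cu.
pose F t := (\int[lebesgue_measure]_(s in `[(a - 1)%R, t]) u s)%R.
exists (fun t => F t - F a); split; first by rewrite subrr.
move=> t at_.
have [dF F't] : derivable F t 1 /\ derive1 F t = u t.
  have iu : lebesgue_measure.-integrable `[(a - 1)%R, (t + 1)%R] (EFin \o u).
    apply: continuous_compact_integrable; first exact: segment_compact.
    exact: continuous_subspaceT.
  have tt : t < t + 1 by rewrite ltrDl.
  exact: (continuous_FTC1_closed tt iu at_ (cu t)).
have := is_deriveB (derivableP dF) (is_derive_cst (F a) t 1).
by rewrite subr0 -derive1E F't.
Qed.

Lemma antiderivative_col (u : R -> 'cV[R]_m) a v : continuous u ->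
  exists U : R -> 'cV[R]_m, U a = v /\ forall t, a - 1 < t -> is_derive t 1 U (u t).
Proof.
move=> cu.
have H i : exists U : R -> R, U a = 0 /\ forall t, a - 1 < t -> is_derive t 1 U (u t i 0).
  apply: antiderivative => t.
  exact: (continuous_comp (cu t) (@coord_continuous _ _ _ i 0 (u t))).
have [U HU] := choice H.
exists (fun t => \col_i (v i 0 + U i t)); split.
  by apply/matrixP => i j; rewrite mxE (HU i).1 addr0 ord1.
move=> t at_; apply/is_derive_colP => i.
under eq_fun do rewrite mxE.
have := is_deriveD (is_derive_cst (v i 0) t 1) ((HU i).2 t at_).
by rewrite add0r.
Qed.

End GlobalODE.

(** * Global existence for a Lipschitz differential equation on a half-line *)

Section Picard.
Set Implicit Arguments. Unset Strict Implicit.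
Variables (R : realType) (m : nat) (F : R -> 'cV[R]_m -> 'cV[R]_m) (L M a : R) (v : 'cV[R]_m).
Hypothesis Fcont : continuous (fun q : R * 'cV[R]_m => F q.1 q.2).
Hypothesis L0 : 0 < L.
Hypothesis Flip : forall t x y, `|F t x - F t y| <= L * `|x - y|.
Hypothesis Fv : forall t, `|F t v| <= M.
Implicit Types (X Y : R -> 'cV[R]_m) (t s : R).

(* Precomposition with [max _ a] turns functions that are only controlled on
   [a, +oo) into continuous functions on the line. *)
Let cut X t := X (Num.max t a).

Let cut_id X t : a <= t -> cut X t = X t.
Proof. by move=> at_; rewrite /cut max_l. Qed.

Let cut_continuous X X' : (forall t, a <= t -> is_derive t 1 X (X' t)) ->
  continuous (cut X).
Proof.
move=> dX t; apply: (@continuous_comp _ _ _ (fun t => Num.max t a) X).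
  by apply: continuous_max; [exact: cvg_id|exact: cvg_cst].
by apply: (is_derive_continuous (dX _ _)); rewrite le_max lexx orbT.
Qed.

(** The continuity premise sits under the existential, so that choice yields an operator defined on
    all functions. *)
Let picard_step X : exists Y, continuous (cut X) ->
  Y a = v /\ forall t, a <= t -> is_derive t 1 Y (F t (cut X t)).
Proof.
have [cX|ncX] := pselect (continuous (cut X)); last by exists X.
have cF : continuous (fun t => F t (cut X t)).
  move=> t; apply: (@continuous2_cvg _ _ _ _ _ _ (fun t => t) (cut X) F).
  - exact: (@Fcont (t, cut X t)).
  - exact: cvg_id.
  - exact: cX.
have [Y [Ya dY]] := antiderivative_col a v cF.
exists Y => _; split => // t at_.
have at1 : a - 1 < t by lra.
exact: dY at1.
Qed.

(** Weight of Bielecki type: measured against [expR (2 * L * (t - a))], one Picard step halves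
    distances on the whole half-line, so no local solutions have to be continued. *)
Let growth B t := B * expR (2 * L * (t - a)).

Let growth_derive B t : is_derive t 1 (fun t => B / (2 * L) * expR (2 * L * (t - a)))
  (growth B t).
Proof.
have d1 : is_derive t 1 (fun t => 2 * L * (t - a)) (2 * L).
  have := is_deriveM (is_derive_cst (2 * L) t 1)
    (is_deriveB (is_derive_id t 1) (is_derive_cst a t 1)).
  by rewrite subr0 scaler0 addr0 [_ *: _]mulr1.
have := is_deriveM (is_derive_cst (B / (2 * L)) t 1)
  (is_derive1_comp (f := expR) (g := fun t => 2 * L * (t - a)) (is_derive_expR (2 * L * (t - a))) d1).
rewrite scaler0 addr0 /growth => H; apply: is_derive_eq H _.
transitivity (B / (2 * L) * (expR (2 * L * (t - a)) * (2 * L))); first by [].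
by field; rewrite gt_eqF.
Qed.

Let compare Y Y' Z Z' B t : a <= t ->  0 <= B -> Y a = Z a ->
  (forall s, a <= s -> is_derive s 1 Y (Y' s)) ->
  (forall s, a <= s -> is_derive s 1 Z (Z' s)) ->
  (forall s, a <= s -> `|Y' s - Z' s| <= growth (2 * L * B) s) ->
  `|Y t - Z t| <= growth B t.
Proof.
move=> at_ B0 YZ dY dZ H.
have dYZ s : a <= s -> is_derive s 1 (fun s => Y s - Z s) (Y' s - Z' s).
  by move=> as_; apply: is_deriveB; [exact: dY|exact: dZ].
have := increment_le_col at_ (fun s as_ _ => dYZ s as_)
  (fun s _ _ => growth_derive (2 * L * B) s) (fun s as_ _ => H s as_).
rewrite YZ !subrr subr0 mulr0 expR0 mulr1 => h; apply: le_trans h _.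
have -> : 2 * L * B / (2 * L) = B by field; rewrite gt_eqF.
by rewrite /growth; lra.
Qed.

Theorem picard : exists X, X a = v /\
  forall t, a <= t -> is_derive t 1 X (F t (X t)).
Proof.
have [T HT] := choice picard_step.
pose X n := iter n T (fun=> v).
have X0c : continuous (cut (X 0%N)) by move=> t; exact: cvg_cst.
have M0 : 0 <= M by apply: le_trans (Fv a).
have cX n : continuous (cut (X n)).
  elim: n => [//|n IH]; exact: cut_continuous (HT _ IH).2.
have dX n t : a <= t -> is_derive t 1 (X n.+1) (F t (X n t)).
  by move=> at_; have := (HT _ (cX n)).2 t at_; rewrite cut_id.
have Xa n : X n a = v by case: n => // n; exact: (HT _ (cX n)).1.
(* Chosen so that [2 * L * B = M], which bounds the derivative of the first iterate. *)
pose B := M / (2 * L).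
have B0 : 0 <= B by rewrite divr_ge0// mulr_ge0// ltW.
have growth_half n t : growth (2 * L * (B * 2^-1 ^+ n.+1)) t = L * growth (B * 2^-1 ^+ n) t.
  by rewrite /growth exprS; field.
have step n t : a <= t -> `|X n.+1 t - X n t| <= growth (B * 2^-1 ^+ n) t.
  elim: n t => [|n IH] t at_.
    apply: (compare at_ _ _ (dX 0%N) (fun s _ => is_derive_cst v s 1)).
    - by rewrite expr0 mulr1.
    - by rewrite Xa.
    - move=> s as_; rewrite subr0; apply: le_trans (Fv s) _.
      have -> : 2 * L * (B * 2^-1 ^+ 0) = M by rewrite /B; field; rewrite gt_eqF.
      rewrite ler_peMr// -expR0 ler_expR !mulr_ge0 ?subr_ge0// ltW//.
  apply: (compare at_ _ _ (dX n.+1) (dX n)); rewrite ?Xa//.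
    by rewrite mulr_ge0// exprn_ge0.
  move=> s as_; rewrite growth_half; apply: le_trans (Flip _ _ _) _.
  by rewrite ler_pM2l// IH.
have lim t : exists l, a <= t -> forall n, `|X n t - l| <= growth (2 * B * 2^-1 ^+ n) t.
  have [at_|ta] := leP a t; last by exists v.
  have [||||l Hl] := @geometric_increments_col _ _ (fun n => X n t) 2^-1 (growth B t) => //.
  - by rewrite invf_lt1// ltr1n.
  - by rewrite mulr_ge0// expR_ge0.
  - move=> n; have := step n t at_; rewrite /growth => h; apply: le_trans h _.
    by rewrite mulrAC.
  exists l => _ n; apply: le_trans (Hl n) _; rewrite le_eqVlt; apply/orP; left; apply/eqP.
  by rewrite /growth; field.
have [Z HZ] := choice lim.
have growth_mono n s t : s <= t -> growth (2 * B * 2^-1 ^+ n) s <= growth (2 * B * 2^-1 ^+ n) t.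
  move=> st; apply: ler_wpM2l; last by rewrite ler_expR ler_pM2l ?mulr_gt0// lerD2r.
  by rewrite mulr_ge0 ?exprn_ge0// mulr_ge0.
have growth_small t e : 0 < e -> exists n, growth (2 * B * 2^-1 ^+ n) t <= e.
  move=> e0; have [|||n Hn] := @geometric_small R (2 * B * expR (2 * L * (t - a))) e 2^-1 => //.
    by rewrite invf_lt1// ltr1n.
  by exists n; rewrite /growth mulrAC.
have cZ : continuous (cut Z).
  move=> t; apply/cvgrPdist_le => e e0.
  have e30 : 0 < e / 3 by rewrite divr_gt0.
  have [n Hn] := growth_small (Num.max (t + 1) a) _ e30.
  have HZ' s : s < t + 1 -> `|X n (Num.max s a) - Z (Num.max s a)| <= e / 3.
    move=> st; apply: le_trans (HZ (Num.max s a) _ n) _; first by rewrite le_max lexx orbT.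
    apply: le_trans Hn; apply: growth_mono.
    by rewrite ge_max !le_max lexx orbT (ltW st).
  have /cvgrPdist_le /(_ _ e30) Xt := cX n t.
  near=> s.
  have h1 : `|cut (X n) t - cut (X n) s| <= e / 3 by near: s.
  have h2 := HZ' t ltac:(lra).
  have h3 : `|X n (Num.max s a) - Z (Num.max s a)| <= e / 3.
    apply: HZ'; near: s; apply: lt_nbhsl; lra.
  rewrite /cut in h1 *.
  have := ler_distD (X n (Num.max t a)) (Z (Num.max t a)) (Z (Num.max s a)).
  have := ler_distD (X n (Num.max s a)) (X n (Num.max t a)) (Z (Num.max s a)).
  rewrite [`|Z _ - X n _|]distrC; lra.
(* [Z] is uncontrolled to the left of [a], so the solution returned is [T Z], which has a two-sided
   derivative at [a] and agrees with [Z] from [a] on. *)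
have [TZa dTZ] := HT _ cZ.
have TZ t : a <= t -> T Z t = Z t.
  move=> at_; apply/eqP; rewrite -subr_eq0 -normr_le0; apply/ler_addgt0Pr => e e0.
  rewrite add0r; have [n Hn] := growth_small t _ (divr_gt0 e0 (ltr0Sn R 1)).
  have h1 := HZ t at_ n.+1.
  have h2 : `|T Z t - X n.+1 t| <= growth (B * 2^-1 ^+ n) t.
    apply: (compare at_ _ _ dTZ (dX n)); rewrite ?Xa//.
      by rewrite mulr_ge0// exprn_ge0.
    move=> s as_; apply: le_trans (Flip _ _ _) _; rewrite cut_id// distrC.
    apply: (@le_trans _ _ (L * growth (2 * B * 2^-1 ^+ n) s)).
      by rewrite ler_pM2l// HZ.
    by rewrite /growth; lra.
  have := ler_distD (X n.+1 t) (T Z t) (Z t).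
  move: h1 h2 Hn; rewrite /growth exprS; lra.
exists (T Z); split => // t at_.
by have := dTZ t at_; rewrite cut_id// TZ.
Unshelve. all: by end_near. Qed.

End Picard.

(** * Transfer of limits and derivatives between locally equal functions *)

Section LocalEquality.
Set Implicit Arguments. Unset Strict Implicit.
Variables (R : realType) (m : nat).
Implicit Types (y z : R -> 'cV[R]_m) (a b t : R).

Lemma eq_in_is_derive y z a b t (d : 'cV[R]_m) : a < t -> t < b ->
  (forall s, a < s -> s < b -> y s = z s) -> is_derive t 1 y d -> is_derive t 1 z d.
Proof.
move=> at_ tb yz; apply: near_eq_is_derive.
near=> s; apply: yz; near: s; [exact: lt_nbhsr|exact: lt_nbhsl].
Unshelve. all: by end_near. Qed.

Lemma eq_in_at_left y z a b : a < b ->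
  (forall s, a < s -> s <= b -> y s = z s) ->
  y @ at_left b --> y b -> z @ at_left b --> z b.
Proof.
move=> ab yz; rewrite -(yz b ab (lexx _)); apply: cvg_trans; apply: near_eq_cvg.
near=> s; apply: yz; last by apply: ltW; near: s; exact: nbhs_left_lt.
by near: s; exact: nbhs_left_gt.
Unshelve. all: by end_near. Qed.

Lemma eq_in_at_right y z a b (r : 'cV[R]_m) : a < b ->
  (forall s, a < s -> s < b -> y s = z s) ->
  y @ at_right a --> r -> z @ at_right a --> r.
Proof.
move=> ab yz; apply: cvg_trans; apply: near_eq_cvg.
near=> s; apply: yz; near: s; [exact: nbhs_right_gt|exact: nbhs_right_lt].
Unshelve. all: by end_near. Qed.

Lemma is_derive_shift_col y t (c : R) (d : 'cV[R]_m) :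
  is_derive (t + c) 1 y d -> is_derive t 1 (fun s => y (s + c)) d.
Proof.
move=> /is_derive_colP H; apply/is_derive_colP => i.
have := is_derive1_comp (f := fun s => y s i 0) (g := shift c) (H i) (is_derive_shift t 1 c).
by rewrite mulr1.
Qed.

Lemma mulmx_col_continuous (A : 'M[R]_m) : continuous (fun x : 'cV[R]_m => A *m x).
Proof.
have [K K0 HK] := enorm_mulmx_bound A.
have Km : 0 < K * (m%:R + 1) by rewrite mulr_gt0// ltr_wpDl.
move=> x; apply/(@cvgrPdist_le _ 'cV[R]_m _ (nbhs x) (nbhs_filter x)) => e e0.
have eK : 0 < e / (K * (m%:R + 1)) by rewrite divr_gt0.
have /cvgrPdist_le /(_ _ eK) : (fun y : 'cV[R]_m => y) @ x --> x by exact: cvg_id.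
apply: filterS => y; rewrite ler_pdivlMr// mulrC -mulmxBr -mulrA => H.
apply: le_trans (norm_le_enorm _) _; apply: le_trans (HK _) _; apply: le_trans H.
rewrite ler_pM2l//; apply: le_trans (enorm_le_norm _) _.
by rewrite mulrDl lerDl mul1r.
Qed.

End LocalEquality.

(** * Solutions of the impulsive system on a single piece *)

Section Pieces.
Set Implicit Arguments. Unset Strict Implicit.
Variables (R : realType) (m : nat) (A B : 'M[R]_m) (f : R -> 'cV[R]_m -> 'cV[R]_m)
  (h : 'cV[R]_m -> 'cV[R]_m) (theta : int -> R) (Mf Mh Mg Lf Lh : R).
Variables (nu : int -> 'cV[R]_m -> R) (rho K : R).
Implicit Types (k : int) (v w gam : 'cV[R]_m) (x y X : R -> 'cV[R]_m) (t s c : R).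

Hypothesis theta_lt : forall k1 k2, (k1 < k2)%R -> theta k1 < theta k2.
Hypothesis fcont : continuous (fun q : R * 'cV[R]_m => f q.1 q.2).
Hypotheses (Mf0 : 0 < Mf) (Mh0 : 0 < Mh) (Mg0 : 0 < Mg) (Lf0 : 0 < Lf) (Lh0 : 0 < Lh).
Hypothesis f_le : forall t v, enorm (f t v) <= Mf.
Hypothesis h_le : forall v, enorm (h v) <= Mh.
Hypothesis f_lip : forall t v w, enorm (f t v - f t w) <= Lf * enorm (v - w).
Hypothesis h_lip : forall v w, enorm (h v - h w) <= Lh * enorm (v - w).
Let C := 1%:M + B.
Hypothesis nu_step : forall k (psi : R -> 'cV[R]_m) v c, 0 <= c ->
  quasi_linear A Lf c (theta k) (theta (k + 1)) psi ->
  enorm (psi (theta k) - C *m v) <= Lh * enorm v + c ->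
  nu (k + 1) (psi (theta (k + 1))) <= rho * nu k v + K * c.
Hypothesis nu_piece : forall k (psi : R -> 'cV[R]_m) v c t, 0 <= c ->
  quasi_linear A Lf c (theta k) (theta (k + 1)) psi ->
  enorm (psi (theta k) - C *m v) <= Lh * enorm v + c ->
  theta k <= t -> t <= theta (k + 1) -> enorm (psi t) <= K * (nu k v + c).

Definition jump v := C *m v + h v.
Definition vfield gam t v := A *m v + f t v + gam.

(** [g] is constant on each piece; making its value a parameter allows comparing motions under
    different forcing, such as a solution and its shift. *)
Definition on_piece k gam y :=
  [/\ forall t, theta k < t -> t < theta (k + 1) -> is_derive t 1 y (vfield gam t (y t)),
      y @ at_left (theta (k + 1)) --> y (theta (k + 1)) &
      jump_ok B h theta y k].

Let thS k : theta k < theta (k + 1).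
Proof. by apply: theta_lt; rewrite ltrDl. Qed.

Lemma jump_okP y k : jump_ok B h theta y k <-> y @ at_right (theta k) --> jump (y (theta k)).
Proof.
rewrite /jump /C mulmxDl mul1mx; split=> [[r [yr E]]|H].
  by rewrite -addrA -E addrC subrK.
exists (y (theta k) + B *m y (theta k) + h (y (theta k))); split => //.
by apply/eqP; rewrite subr_eq [eqbRHS]addrC addrA.
Qed.

Lemma vfield_diff gam1 gam2 t v w :
  enorm (vfield gam1 t v - vfield gam2 t w - A *m (v - w)) <=
  Lf * enorm (v - w) + enorm (gam1 - gam2).
Proof.
have -> : vfield gam1 t v - vfield gam2 t w - A *m (v - w) =
    (f t v - f t w) + (gam1 - gam2).
  by rewrite mulmxBr /vfield; apply/matrixP => i j; rewrite !mxE; ring.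
by apply: le_trans (enormD _ _) _; rewrite lerD2r.
Qed.

Lemma vfield_near gam t v : enorm gam <= Mg ->
  enorm (vfield gam t v - A *m v) <= Lf * enorm v + (Mf + Mg + Mh).
Proof.
move=> gM; have -> : vfield gam t v - A *m v = f t v + gam.
  by rewrite /vfield; apply/matrixP => i j; rewrite !mxE; ring.
have := enormD (f t v) gam; have := f_le t v.
have : 0 <= Lf * enorm v by rewrite mulr_ge0 ?enorm_ge0 ?(ltW Lf0).
have := Mh0; lra.
Qed.

Lemma on_piece_diff k gam1 gam2 y1 y2 c :
  on_piece k gam1 y1 -> on_piece k gam2 y2 -> enorm (gam1 - gam2) <= c ->
  nu (k + 1) (y1 (theta (k + 1)) - y2 (theta (k + 1))) <=
    rho * nu k (y1 (theta k) - y2 (theta k)) + K * c /\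
  forall t, theta k < t -> t <= theta (k + 1) ->
    enorm (y1 t - y2 t) <= K * (nu k (y1 (theta k) - y2 (theta k)) + c).
Proof.
move=> [d1 l1 /jump_okP j1] [d2 l2 /jump_okP j2] gc.
have c0 : 0 <= c by apply: le_trans gc; exact: enorm_ge0.
(* The difference with its value at [theta k] replaced by the state after the impulse, which makes
   it right continuous there. *)
pose psi t := if t <= theta k then jump (y1 (theta k)) - jump (y2 (theta k)) else y1 t - y2 t.
have psiE t : theta k < t -> psi t = y1 t - y2 t by move=> kt; rewrite /psi leNgt kt.
have psik : psi (theta k) = jump (y1 (theta k)) - jump (y2 (theta k)) by rewrite /psi lexx.
have Q : quasi_linear A Lf c (theta k) (theta (k + 1)) psi.
  split.
  - rewrite psik; apply: (@eq_in_at_right _ _ (fun t => y1 t - y2 t) _ _ _ _ (thS k)).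
      by move=> s ks _; rewrite psiE.
    by apply: cvgB.
  - apply: (@eq_in_at_left _ _ (fun t => y1 t - y2 t) _ _ _ (thS k)).
      by move=> s ks _; rewrite psiE.
    by apply: cvgB.
  - move=> t kt tk; exists (vfield gam1 t (y1 t) - vfield gam2 t (y2 t)).
      apply: (@eq_in_is_derive _ _ (fun t => y1 t - y2 t) _ _ _ _ _ kt tk).
        by move=> s ks _; rewrite psiE.
      by apply: is_deriveB; [exact: d1|exact: d2].
    by rewrite psiE//; apply: le_trans (vfield_diff _ _ _ _ _) _; rewrite lerD2l.
have J : enorm (psi (theta k) - C *m (y1 (theta k) - y2 (theta k))) <=
    Lh * enorm (y1 (theta k) - y2 (theta k)) + c.
  rewrite psik; have -> : jump (y1 (theta k)) - jump (y2 (theta k)) -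
      C *m (y1 (theta k) - y2 (theta k)) = h (y1 (theta k)) - h (y2 (theta k)).
    by rewrite mulmxBr /jump; apply/matrixP => i j; rewrite !mxE; ring.
  by apply: le_trans (h_lip _ _) _; rewrite lerDl.
split; first by rewrite -psiE//; exact: nu_step.
by move=> t kt tk; rewrite -psiE//; apply: nu_piece => //; exact: ltW.
Qed.

(** All nonlinear terms are treated as forcing. The single constant [Mf + Mg + Mh] covers both the
    drift, bounded by [Mf + Mg], and the impulse, bounded by [Mh]. *)
Lemma on_piece_bound k gam y : on_piece k gam y -> enorm gam <= Mg ->
  nu (k + 1) (y (theta (k + 1))) <= rho * nu k (y (theta k)) + K * (Mf + Mg + Mh) /\
  forall t, theta k < t -> t <= theta (k + 1) ->
    enorm (y t) <= K * (nu k (y (theta k)) + (Mf + Mg + Mh)).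
Proof.
move=> [d1 l1 /jump_okP j1] gM.
have c0 : 0 <= Mf + Mg + Mh by rewrite !addr_ge0// ltW.
pose psi t := if t <= theta k then jump (y (theta k)) else y t.
have psiE t : theta k < t -> psi t = y t by move=> kt; rewrite /psi leNgt kt.
have psik : psi (theta k) = jump (y (theta k)) by rewrite /psi lexx.
have Q : quasi_linear A Lf (Mf + Mg + Mh) (theta k) (theta (k + 1)) psi.
  split.
  - rewrite psik; apply: (eq_in_at_right (thS k) _ j1).
    by move=> s ks _; rewrite psiE.
  - apply: (eq_in_at_left (thS k) _ l1).
    by move=> s ks _; rewrite psiE.
  - move=> t kt tk; exists (vfield gam t (y t)).
      apply: (eq_in_is_derive kt tk _ (d1 t kt tk)).
      by move=> s ks _; rewrite psiE.
    by rewrite psiE//; exact: vfield_near.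
have J : enorm (psi (theta k) - C *m y (theta k)) <= Lh * enorm (y (theta k)) + (Mf + Mg + Mh).
  rewrite psik /jump addrC addKr.
  have : 0 <= Lh * enorm (y (theta k)) by rewrite mulr_ge0 ?enorm_ge0 ?(ltW Lh0).
  have := h_le (y (theta k)); have := Mf0; have := Mg0; lra.
split; first by rewrite -psiE//; exact: nu_step.
by move=> t kt tk; rewrite -psiE//; apply: nu_piece => //; exact: ltW.
Qed.

(* [y] need only agree with the flow strictly after [theta k]: its value at
   [theta k] is the state before the impulse. *)
Lemma on_piece_of_flow k gam X y :
  (forall t, theta k <= t -> is_derive t 1 X (vfield gam t (X t))) ->
  X (theta k) = jump (y (theta k)) ->
  (forall t, theta k < t -> t <= theta (k + 1) -> y t = X t) -> on_piece k gam y.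
Proof.
move=> dX Xk yX; split.
- move=> t kt tk; rewrite yX ?(ltW tk)//.
  apply: (eq_in_is_derive kt tk _ (dX t (ltW kt))) => s ks sk.
  by rewrite yX// ltW.
- apply: (@eq_in_at_left _ _ X _ _ _ (thS k)) => [s ks sk|]; first by rewrite yX.
  exact/cvg_at_left_filter/(is_derive_continuous (dX _ (ltW (thS k)))).
- apply/jump_okP; rewrite -Xk.
  apply: (@eq_in_at_right _ _ X _ _ _ _ (thS k)) => [s ks sk|]; first by rewrite yX// ltW.
  exact/cvg_at_right_filter/(is_derive_continuous (dX _ (lexx _))).
Qed.

Lemma flow_exists a gam v : exists X, X a = v /\
  forall t, a <= t -> is_derive t 1 X (vfield gam t (X t)).
Proof.
have [KA KA0 HKA] := enorm_mulmx_bound A.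
have Lpos : 0 < (KA + Lf) * (m%:R + 1) by apply: mulr_gt0; [exact: addr_gt0|rewrite ltr_wpDl].
apply: (@picard _ _ (vfield gam) ((KA + Lf) * (m%:R + 1)) (KA * enorm v + Mf + enorm gam)) => //.
- move=> q.
  have cA : {for q, continuous (fun z : R * 'cV[R]_m => A *m z.2)}.
    by apply: (continuous_comp (f := snd)); [exact: cvg_snd|exact: mulmx_col_continuous].
  exact: (cvgD (cvgD cA (@fcont q)) (cvg_cst gam)).
- move=> t x y; apply: le_trans (norm_le_enorm _) _.
  apply: (@le_trans _ _ ((KA + Lf) * enorm (x - y))).
    have := vfield_diff gam gam t x y; rewrite subrr enorm0 addr0.
    have := HKA (x - y).
    have := enormD (vfield gam t x - vfield gam t y - A *m (x - y)) (A *m (x - y)).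
    rewrite subrK mulrDl; lra.
  rewrite -mulrA ler_wpM2l//; first by rewrite addr_ge0// ltW.
  apply: le_trans (enorm_le_norm _) _.
  by rewrite mulrDl lerDl mul1r.
- move=> t; apply: le_trans (norm_le_enorm _) _; rewrite /vfield.
  have := enormD (A *m v + f t v) gam; have := enormD (A *m v) (f t v).
  by have := HKA v; have := f_le t v; lra.
Qed.

End Pieces.

(** * Existence and uniqueness of the bounded solution *)

Section BoundedSolution.
Set Implicit Arguments. Unset Strict Implicit.
Variables (R : realType) (m : nat) (A B : 'M[R]_m) (f : R -> 'cV[R]_m -> 'cV[R]_m)
  (h : 'cV[R]_m -> 'cV[R]_m) (theta : int -> R).
Variables (nu : int -> 'cV[R]_m -> R) (rho K c0 Mg : R) (G : int -> 'cV[R]_m).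
Implicit Types (k j : int) (u v w gam : 'cV[R]_m) (x y X : R -> 'cV[R]_m) (t s c : R).
Local Notation vf := (vfield A f).
Local Notation piece := (on_piece A B f h theta).
Local Notation J := (jump B h).

Hypothesis theta_lt : forall k1 k2, (k1 < k2)%R -> theta k1 < theta k2.
Hypothesis pieceE : forall t, exists k, theta k < t <= theta (k + 1).
Hypothesis piece_inj : forall k j t, theta k < t <= theta (k + 1) ->
  theta j < t <= theta (j + 1) -> k = j.
Hypotheses (rho0 : 0 < rho) (rho1 : rho < 1) (K1 : 1 <= K) (c00 : 0 <= c0).
Hypothesis enorm_nu : forall k v, enorm v <= K * nu k v.
Hypothesis nu_enorm : forall k v, nu k v <= K * enorm v.
Hypothesis G_le : forall k, enorm (G k) <= Mg.
Hypothesis diffH : forall k gam1 gam2 y1 y2 c,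
  piece k gam1 y1 -> piece k gam2 y2 -> enorm (gam1 - gam2) <= c ->
  nu (k + 1) (y1 (theta (k + 1)) - y2 (theta (k + 1))) <=
    rho * nu k (y1 (theta k) - y2 (theta k)) + K * c /\
  forall t, theta k < t -> t <= theta (k + 1) ->
    enorm (y1 t - y2 t) <= K * (nu k (y1 (theta k) - y2 (theta k)) + c).
Hypothesis boundH : forall k gam y, piece k gam y -> enorm gam <= Mg ->
  nu (k + 1) (y (theta (k + 1))) <= rho * nu k (y (theta k)) + K * c0 /\
  forall t, theta k < t -> t <= theta (k + 1) ->
    enorm (y t) <= K * (nu k (y (theta k)) + c0).
Hypothesis flowH : forall a gam v, exists X, X a = v /\
  forall t, a <= t -> is_derive t 1 X (vf gam t (X t)).

Let K0 : 0 < K.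
Proof. exact: lt_le_trans ltr01 K1. Qed.

Let nu_ge0 k v : 0 <= nu k v.
Proof. by rewrite -(pmulr_rge0 _ K0); apply: le_trans (enorm_nu k v); exact: enorm_ge0. Qed.

Let thS k : theta k < theta (k + 1).
Proof. by apply: theta_lt; rewrite ltrDl. Qed.

Let rho1' : 0 < 1 - rho.
Proof. by rewrite subr_gt0. Qed.

(** [K * c / (1 - rho)] is the fixed point of [d = rho * d + K * c], so it bounds the accumulated
    effect of the forcing difference for every [n]. *)
Lemma iterate_diff k0 n (gam1 gam2 : int -> 'cV[R]_m) y1 y2 c : 0 <= c ->
  (forall j, k0 <= j -> j < k0 + n%:Z -> [/\ piece j (gam1 j) y1, piece j (gam2 j) y2 &
     enorm (gam1 j - gam2 j) <= c]) ->
  nu (k0 + n%:Z) (y1 (theta (k0 + n%:Z)) - y2 (theta (k0 + n%:Z))) <=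
    rho ^+ n * nu k0 (y1 (theta k0) - y2 (theta k0)) + K * c / (1 - rho).
Proof.
move=> cge0; have d0 : 0 <= K * c / (1 - rho).
  by rewrite divr_ge0 ?(ltW rho1')// mulr_ge0// ltW.
elim: n => [_|n IH H]; first by rewrite addr0 expr0 mul1r lerDl.
have [||p1 p2 gc] := H (k0 + n%:Z).
- by rewrite lerDl.
- by rewrite ltrD2l ltz_nat.
have lt1 : k0 + n%:Z < k0 + n.+1%:Z by rewrite ltrD2l ltz_nat.
have IH' := IH (fun j h1 h2 => H j h1 (lt_trans h2 lt1)).
have -> : k0 + n.+1%:Z = k0 + n%:Z + 1 by rewrite intS addrA addrAC.
apply: le_trans (diffH p1 p2 gc).1 _.
apply: le_trans (lerD (ler_wpM2l (ltW rho0) IH') (lexx _)) _.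
rewrite le_eqVlt; apply/orP; left; apply/eqP; rewrite exprS; field.
by rewrite gt_eqF.
Qed.

(** Starting [n] pieces earlier, where the distance is bounded independently of [n], leaves a factor
    [rho ^+ n] at [theta k]. *)
Lemma bounded_unique y1 y2 (M1 M2 : R) :
  (forall k, piece k (G k) y1) -> (forall k, piece k (G k) y2) ->
  (forall t, enorm (y1 t) <= M1) -> (forall t, enorm (y2 t) <= M2) -> y1 = y2.
Proof.
move=> p1 p2 b1 b2.
have nuM k : nu k (y1 (theta k) - y2 (theta k)) <= K * (M1 + M2).
  apply: le_trans (nu_enorm _ _) _; rewrite ler_pM2l//.
  by apply: le_trans (enormB _ _) _; exact: lerD.
have nu0 k : nu k (y1 (theta k) - y2 (theta k)) <= 0.
  apply/ler_addgt0Pr => e e0; rewrite add0r.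
  have [n Hn] := geometric_small (K * (M1 + M2)) (ltW rho0) rho1 e0.
  have := @iterate_diff (k - n%:Z) n G G y1 y2 0 (lexx _).
  rewrite subrK mulr0 mul0r addr0 => /(_ _)/le_trans; apply.
    by move=> j _ _; split => //; rewrite subrr enorm0.
  apply: le_trans Hn; rewrite mulrC ler_wpM2r// exprn_ge0//; exact: ltW.
apply/funext => t; have [k /andP[kt tk]] := pieceE t.
apply/eqP; rewrite -subr_eq0; apply/eqP/enorm_eq0.
have := (@diffH k (G k) (G k) y1 y2 0 (p1 k) (p2 k)).
rewrite subrr enorm0 => /(_ (lexx _))[_ /(_ t kt tk)] H.
by apply: le_trans H _; rewrite addr0 pmulr_rle0.
Qed.

(* For each [k] the discrete orbit started at zero [n] steps before [k] is
   Cauchy in [n]; its limit is a bounded orbit of the time-[theta] maps [Phi],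
   and the flows on the pieces interpolate it. *)
Theorem bounded_solution_exists : exists x, exists Xk : int -> R -> 'cV[R]_m, exists D : R,
  [/\ (forall k t, theta k < t -> t <= theta (k + 1) -> x t = Xk k t),
      (forall k t, theta k <= t -> is_derive t 1 (Xk k) (vf (G k) t (Xk k t))),
      (forall k, Xk k (theta k) = J (x (theta k))) &
      (forall t, enorm (x t) <= D)].
Proof.
have [X HX] := choice (fun kv : int * 'cV[R]_m => flowH (theta kv.1) (G kv.1) (J kv.2)).
(* Before the impulse the state is [u], after it the flow started at the jump of [u]; thus [Phi]
   below maps left limits to left limits. *)
pose yk k u t := if t <= theta k then u else X (k, u) t.
have ykE k u t : theta k < t -> yk k u t = X (k, u) t by move=> kt; rewrite /yk leNgt kt.
have yk0 k u : yk k u (theta k) = u by rewrite /yk lexx.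
have pyk k u : piece k (G k) (yk k u).
  apply: (on_piece_of_flow theta_lt (X := X (k, u))).
  - exact: (HX (k, u)).2.
  - by rewrite yk0 (HX (k, u)).1.
  - by move=> t kt _; exact: ykE.
pose Phi k u := yk k u (theta (k + 1)).
have PhiL k u v : nu (k + 1) (Phi k u - Phi k v) <= rho * nu k (u - v).
  have [+ _] := diffH (c := 0) (pyk k u) (pyk k v) ltac:(by rewrite subrr enorm0).
  by rewrite !yk0 mulr0 addr0.
have PhiB k u : nu (k + 1) (Phi k u) <= rho * nu k u + K * c0.
  by have [+ _] := boundH (pyk k u) (G_le k); rewrite yk0.
pose orb := fix orb n k := if n is n'.+1 then Phi (k - 1) (orb n' (k - 1)) else 0.
have nu00 k : nu k 0 <= 0 by have := nu_enorm k 0; rewrite enorm0 mulr0.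
have orb_step n k : nu k (orb n.+1 k - orb n k) <= rho ^+ n * (K * c0).
  elim: n k => [|n IH] k.
    have := PhiB (k - 1) 0; rewrite subrK expr0 mul1r subr0 => H; apply: le_trans H _.
    by rewrite gerDr pmulr_rle0.
  have := PhiL (k - 1) (orb n.+1 (k - 1)) (orb n (k - 1)); rewrite subrK => H.
  by apply: le_trans H _; rewrite exprS -mulrA ler_pM2l.
have [D D0 lim] : exists2 D, 0 <= D & forall k, exists l, forall n, `|orb n k - l| <= D * rho ^+ n.
  exists (K * (K * c0) / (1 - rho)) => [|k].
    by rewrite divr_ge0 ?(ltW rho1')// !mulr_ge0// ltW.
  apply: (geometric_increments_col (u := fun n => orb n k) (ltW rho0) rho1).
    by rewrite !mulr_ge0// ltW.
  move=> n; apply: le_trans (norm_le_enorm _) _; apply: le_trans (enorm_nu k _) _.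
  by rewrite -mulrA ler_pM2l// [leRHS]mulrC; exact: orb_step.
have [v Hv] := choice lim.
have vb k : enorm (v k) <= m%:R * D.
  apply: le_trans (enorm_le_norm _) _; rewrite ler_wpM2l//.
  by have := Hv k 0%N; rewrite sub0r normrN expr0 mulr1.
(* By [PhiL] the map [Phi k] is Lipschitz, so the recursion from [orb n k] to [orb n.+1 (k + 1)]
   passes to the limit. *)
have vPhi k : Phi k (v k) = v (k + 1).
  apply/eqP; rewrite -subr_eq0 -normr_le0; apply/ler_addgt0Pr => e e0; rewrite add0r.
  pose Q := K * (K * (m%:R * D)) + D.
  have [n Hn] := geometric_small Q (ltW rho0) rho1 e0.
  have h1 := Hv (k + 1) n.+1.
  rewrite /= addrK in h1.
  have h2 : `|Phi k (v k) - Phi k (orb n k)| <= K * (K * (m%:R * D)) * rho ^+ n.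
    apply: le_trans (norm_le_enorm _) _; apply: le_trans (enorm_nu (k + 1) _) _.
    rewrite -!mulrA ler_pM2l//; apply: le_trans (PhiL _ _ _) _.
    apply: (@le_trans _ _ (nu k (v k - orb n k))); first by rewrite ler_piMl// ltW.
    apply: le_trans (nu_enorm _ _) _; rewrite ler_pM2l//.
    apply: le_trans (enorm_le_norm _) _; rewrite ler_wpM2l// distrC; exact: Hv.
  have h3 : D * rho ^+ n.+1 <= D * rho ^+ n.
    by rewrite ler_wpM2l// exprS ler_piMl ?exprn_ge0// ltW.
  have := ler_distD (Phi k (orb n k)) (Phi k (v k)) (v (k + 1)).
  move: Hn; rewrite /Q mulrDl; lra.
have [idx Hidx] := choice pieceE.
pose x t := X (idx t, v (idx t)) t.
have xE k t : theta k < t -> t <= theta (k + 1) -> x t = X (k, v k) t.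
  move=> kt tk; have E : idx t = k by apply: (piece_inj (Hidx t)); rewrite kt.
  by rewrite /x E.
have xth k : x (theta k) = v k.
  have E := xE (k - 1) (theta k); rewrite subrK in E.
  have k1 : theta (k - 1) < theta k by have := thS (k - 1); rewrite subrK.
  rewrite (E k1 (lexx _)) -(ykE _ _ _ k1) -[v k](congr1 v (subrK 1 k)).
  by rewrite -vPhi /Phi subrK.
have px k : piece k (G k) x.
  apply: (on_piece_of_flow theta_lt (X := X (k, v k))).
  - exact: (HX (k, v k)).2.
  - by rewrite (HX (k, v k)).1 xth.
  - by move=> t kt tk; exact: xE.
(* The flows are exported along with [x] because they remain differentiable at both ends of a piece,
   where [x] may jump. *)
exists x, (fun k => X (k, v k)), (K * (K * (m%:R * D) + c0)); split.
- exact: xE.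
- by move=> k; exact: (HX (k, v k)).2.
- by move=> k; rewrite (HX (k, v k)).1 xth.
- move=> t; have [k /andP[kt tk]] := pieceE t.
  have [_ /(_ t kt tk) H] := boundH (px k) (G_le k).
  apply: le_trans H _; rewrite ler_pM2l// lerD2r xth.
  by apply: le_trans (nu_enorm _ _) _; rewrite ler_pM2l.
Qed.

End BoundedSolution.

(** * From pieces to solutions on the line, and asymptotic stability *)

Section Stability.
Set Implicit Arguments. Unset Strict Implicit.
Variables (R : realType) (m : nat) (A B : 'M[R]_m) (f : R -> 'cV[R]_m -> 'cV[R]_m)
  (g : R -> 'cV[R]_m) (h : 'cV[R]_m -> 'cV[R]_m) (theta : int -> R).
Variables (nu : int -> 'cV[R]_m -> R) (Lf rho K Kp : R) (G : int -> 'cV[R]_m).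
Implicit Types (k j : int) (u v w gam : 'cV[R]_m) (x y X : R -> 'cV[R]_m) (t s c : R).
Local Notation vf := (vfield A f).
Local Notation piece := (on_piece A B f h theta).

Hypothesis theta_lt : forall k1 k2, (k1 < k2)%R -> theta k1 < theta k2.
Hypothesis pieceE : forall t, exists k, theta k < t <= theta (k + 1).
Hypothesis gG : forall k t, theta k < t -> t <= theta (k + 1) -> g t = G k.
Hypotheses (rho0 : 0 < rho) (rho1 : rho < 1) (K1 : 1 <= K) (Kp1 : 1 <= Kp).
Hypothesis enorm_nu : forall k v, enorm v <= K * nu k v.
Hypothesis nu_enorm : forall k v, nu k v <= K * enorm v.
Hypothesis f_lip : forall t v w, enorm (f t v - f t w) <= Lf * enorm (v - w).
Hypothesis diffH : forall k gam1 gam2 y1 y2 c,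
  piece k gam1 y1 -> piece k gam2 y2 -> enorm (gam1 - gam2) <= c ->
  nu (k + 1) (y1 (theta (k + 1)) - y2 (theta (k + 1))) <=
    rho * nu k (y1 (theta k) - y2 (theta k)) + K * c /\
  forall t, theta k < t -> t <= theta (k + 1) ->
    enorm (y1 t - y2 t) <= K * (nu k (y1 (theta k) - y2 (theta k)) + c).
Hypothesis partialH : forall k (psi : R -> 'cV[R]_m) a t c,
  0 <= c -> theta k <= a -> a < theta (k + 1) -> a <= t -> t <= theta (k + 1) ->
  quasi_linear A Lf c a (theta (k + 1)) psi -> enorm (psi t) <= Kp * (enorm (psi a) + c).

Let K0 : 0 < K.
Proof. exact: lt_le_trans ltr01 K1. Qed.

Let thS k : theta k < theta (k + 1).
Proof. by apply: theta_lt; rewrite ltrDl. Qed.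

Let thle k1 k2 : (k1 <= k2)%R -> theta k1 <= theta k2.
Proof. by rewrite le_eqVlt => /predU1P[->//|/theta_lt/ltW]. Qed.

Lemma not_impulse k t : theta k < t -> t < theta (k + 1) -> ~ is_impulse theta t.
Proof.
move=> kt tk [j tj]; rewrite tj in kt tk.
have kj : k < j by rewrite ltNge; apply/negP => /thle; lra.
have : j < k + 1 by rewrite ltNge; apply/negP => /thle; lra.
by rewrite ltzD1 leNgt kj.
Qed.

Lemma solution_from_piece t0 y k : solution_from A B f g h theta t0 y ->
  t0 <= theta k -> piece k (G k) y.
Proof.
move=> [dy _ ly jy] t0k; split; [|by apply: ly; exact: le_lt_trans (thS k)|exact: jy].
move=> t kt tk; have := dy t (le_lt_trans t0k kt) (not_impulse kt tk).
by rewrite /rhs (gG kt (ltW tk)).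
Qed.

Lemma solution_piece y k : solution A B f g h theta y -> piece k (G k) y.
Proof.
move=> [dy ly jy]; split; [|exact: ly|exact: jy].
move=> t kt tk; have := dy t (not_impulse kt tk).
by rewrite /rhs (gG kt (ltW tk)).
Qed.

Lemma piece_derive t y : (forall k, piece k (G k) y) -> ~ is_impulse theta t ->
  is_derive t 1 y (rhs A f g t (y t)).
Proof.
move=> py nt; have [k /andP[kt]] := pieceE t.
rewrite le_eqVlt => /predU1P[tk|tk]; first by case: nt; exists (k + 1).
rewrite /rhs (gG kt (ltW tk)); have [dy _ _] := py k; exact: dy.
Qed.

Lemma pieces_solution y : (forall k, piece k (G k) y) -> solution A B f g h theta y.
Proof.
move=> py; split=> [t|k|k]; first exact: piece_derive.
  by have [_ + _] := py (k - 1); rewrite subrK.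
by have [_ _] := py k.
Qed.

Variable x : R -> 'cV[R]_m.
Hypothesis px : forall k, piece k (G k) x.

(** A perturbation may start inside a piece, whereas the contraction runs between impulse moments.
    This carries it to an impulse moment at or after [t0], with a constant independent of [y]. *)
Let first_piece t0 : exists k, exists2 D : R, 0 <= D & t0 <= theta k /\
  forall y, solution_from A B f g h theta t0 y ->
    (forall t, t0 <= t -> t <= theta k -> enorm (y t - x t) <= D * enorm (y t0 - x t0)) /\
    nu k (y (theta k) - x (theta k)) <= D * enorm (y t0 - x t0).
Proof.
have [k /andP[kt]] := pieceE t0; rewrite le_eqVlt => /predU1P[tk|tk].
  (* If [t0] is an impulse moment, [y t0] is already a state before an impulse and contraction
     starts at once. *)
  exists (k + 1), K; [exact: ltW|split; [by rewrite tk|move=> y sy]].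
  split=> [t tt tk'|]; last by rewrite -tk nu_enorm.
  have -> : t = t0 by apply/le_anti; rewrite tt andbT tk.
  by rewrite ler_peMl ?enorm_ge0.
have Kp0 : 0 <= Kp by apply: le_trans Kp1.
exists (k + 1), (Kp + K * Kp); [by rewrite addr_ge0// mulr_ge0// ltW|].
split; [exact: ltW|move=> y sy].
have Q : quasi_linear A Lf 0 t0 (theta (k + 1)) (fun t => y t - x t).
  have [dy ry ly jy] := sy.
  have ni := not_impulse kt tk.
  split.
  - apply: cvgB; first exact: ry.
    exact/cvg_at_right_filter/(is_derive_continuous (piece_derive px ni)).
  - apply: cvgB; first by apply: ly.
    by have [_ + _] := px k.
  - move=> t tt tk'; have kt' : theta k < t by exact: lt_trans tt.
    exists (rhs A f g t (y t) - rhs A f g t (x t)).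
      apply: is_deriveB; first exact: dy (not_impulse kt' tk').
      exact: piece_derive px (not_impulse kt' tk').
    have := vfield_diff A f_lip (g t) (g t) t (y t) (x t).
    by rewrite subrr enorm0.
have H t : t0 <= t -> t <= theta (k + 1) -> enorm (y t - x t) <= Kp * enorm (y t0 - x t0).
  move=> tt tk'; have := partialH (lexx 0) (ltW kt) tk tt tk' Q.
  by rewrite addr0.
split=> [t tt tk'|].
  apply: le_trans (H t tt tk') _; rewrite ler_wpM2r ?enorm_ge0// lerDl.
  by rewrite mulr_ge0// ltW.
apply: le_trans (nu_enorm _ _) _.
apply: (@le_trans _ _ (K * (Kp * enorm (y t0 - x t0)))).
  by rewrite ler_pM2l// H// ltW.
by rewrite mulrA ler_wpM2r ?enorm_ge0// lerDr.
Qed.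

Lemma asymp_stable_of_pieces : asymp_stable A B f g h theta x.
Proof.
move=> t0; have [k [D D0 [t0k HD]]] := first_piece t0.
(* Past [theta (k + n)] at least [n] pieces have been crossed; [l] counts the further ones, whose
   factor [rho ^+ l <= 1] is dropped. *)
have far y : solution_from A B f g h theta t0 y -> forall n t, theta (k + n%:Z) < t ->
    enorm (y t - x t) <= K * D * enorm (y t0 - x t0) * rho ^+ n.
  move=> sy n t nt; have [j /andP[jt tj]] := pieceE t.
  have nj : k + n%:Z <= j.
    by rewrite -ltzD1 ltNge; apply/negP => /thle; lra.
  have [l jE] : exists l : nat, j = k + Posz (addn n l).
    exists (absz (j - (k + n%:Z))%R); rewrite PoszD addrA.
    by rewrite abszE ger0_norm ?subr_ge0// addrC subrK.
  have kj : t0 <= theta j.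
    by apply: le_trans t0k (thle _); rewrite jE lerDl.
  have pc i : k <= i -> piece i (G i) y.
    by move=> ki; apply: solution_from_piece sy _; apply: le_trans t0k (thle ki).
  have := @diffH j (G j) (G j) y x 0 (solution_from_piece sy kj) (px j).
  rewrite subrr enorm0 => /(_ (lexx _))[_ /(_ t jt tj) H].
  have := iterate_diff rho0 rho1 K1 diffH (k0 := k) (n := addn n l) (gam1 := G) (gam2 := G)
    (y1 := y) (y2 := x) (c := 0) (lexx _).
  rewrite mulr0 mul0r addr0 -jE => /(_ _) I.
  have zz i : enorm (G i - G i) <= 0 by rewrite subrr enorm0.
  have {}I := I (fun i ki _ => And3 (pc i ki) (px i) (zz i)).
  rewrite addr0 in H; apply: le_trans H _; rewrite -!mulrA ler_pM2l//.
  apply: le_trans I _; have [_ nuk] := HD y sy.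
  have nu0 : 0 <= D * enorm (y t0 - x t0) by rewrite mulr_ge0 ?enorm_ge0.
  rewrite mulrA exprD mulrC; apply: ler_pM => //.
  - by rewrite -(pmulr_rge0 _ K0); apply: le_trans (enorm_nu k _); exact: enorm_ge0.
  - by rewrite mulr_ge0// exprn_ge0// ltW.
  - by rewrite ler_piMr ?exprn_ge0 ?exprn_ile1// ltW.
split.
  move=> eps eps0; have DK : 0 < D + K * D + 1.
    by rewrite ltr_wpDl// addr_ge0// mulr_ge0// ltW.
  exists (eps / (D + K * D + 1)); first exact: divr_gt0.
  move=> y sy; rewrite ltr_pdivlMr// => yd t tt.
  have e0 := enorm_ge0 (y t0 - x t0).
  have De : 0 <= D * enorm (y t0 - x t0) by rewrite mulr_ge0.
  have KDe : 0 <= K * D * enorm (y t0 - x t0) by rewrite mulr_ge0// mulr_ge0// ltW.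
  have [tk|kt] := leP t (theta k).
    have [/(_ t tt tk) H _] := HD y sy; lra.
  have := far y sy 0%N t; rewrite addr0 expr0 mulr1 => /(_ kt); lra.
exists 1 => // y sy _; apply/cvgrPdist_le => e e0.
have [n Hn] := geometric_small (K * D * enorm (y t0 - x t0)) (ltW rho0) rho1 e0.
near=> t; rewrite sub0r normrN ger0_norm ?enorm_ge0//.
apply: le_trans Hn; apply: far => //; near: t; apply: nbhs_pinfty_gt; exact: num_real.
Unshelve. all: by end_near. Qed.

End Stability.

(** * Convergence and separation of the shifted solutions *)

Section Unpredictability.
Set Implicit Arguments. Unset Strict Implicit.
Variables (R : realType) (m p : nat) (omega : R) (A B : 'M[R]_m)
  (f : R -> 'cV[R]_m -> 'cV[R]_m) (h : 'cV[R]_m -> 'cV[R]_m) (theta : int -> R)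
  (sigma : int -> 'cV[R]_m).
Variables (nu : int -> 'cV[R]_m -> R) (Lf Mf Mg rho K D : R).
Variables (x : R -> 'cV[R]_m) (Xk : int -> R -> 'cV[R]_m).
Implicit Types (k j : int) (v w gam : 'cV[R]_m) (t s c : R) (n : nat).
Local Notation vf := (vfield A f).
Local Notation piece := (on_piece A B f h theta).
Let G k := sigma (k %/ p%:Z)%Z.

Hypothesis omega0 : 0 < omega.
Hypothesis p0 : (0 < p)%N.
Hypothesis theta_lt : forall k1 k2, (k1 < k2)%R -> theta k1 < theta k2.
Hypothesis theta_per : forall k, theta (k + p%:Z)%R = theta k + omega.
Hypothesis f_per : forall t v, f (t + omega) v = f t v.
Hypotheses (rho0 : 0 < rho) (rho1 : rho < 1) (K1 : 1 <= K) (Lf0 : 0 < Lf).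
Hypothesis enorm_nu : forall k v, enorm v <= K * nu k v.
Hypothesis nu_enorm : forall k v, nu k v <= K * enorm v.
Hypothesis f_lip : forall t v w, enorm (f t v - f t w) <= Lf * enorm (v - w).
Hypothesis f_le : forall t v, enorm (f t v) <= Mf.
Hypothesis sigma_le : forall k, enorm (sigma k) <= Mg.
Hypothesis diffH : forall k gam1 gam2 y1 y2 c,
  piece k gam1 y1 -> piece k gam2 y2 -> enorm (gam1 - gam2) <= c ->
  nu (k + 1) (y1 (theta (k + 1)) - y2 (theta (k + 1))) <=
    rho * nu k (y1 (theta k) - y2 (theta k)) + K * c /\
  forall t, theta k < t -> t <= theta (k + 1) ->
    enorm (y1 t - y2 t) <= K * (nu k (y1 (theta k) - y2 (theta k)) + c).
Hypothesis xX : forall k t, theta k < t -> t <= theta (k + 1) -> x t = Xk k t.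
Hypothesis dX : forall k t, theta k <= t -> is_derive t 1 (Xk k) (vf (G k) t (Xk k t)).
Hypothesis X0 : forall k, Xk k (theta k) = jump B h (x (theta k)).
Hypothesis xD : forall t, enorm (x t) <= D.

Let K0 : 0 < K.
Proof. exact: lt_le_trans ltr01 K1. Qed.

Let thS k : theta k < theta (k + 1).
Proof. by apply: theta_lt; rewrite ltrDl. Qed.

Let thle k1 k2 : (k1 <= k2)%R -> theta k1 <= theta k2.
Proof. exact: theta_le. Qed.

Let pieceE : forall t, exists k, theta k < t <= theta (k + 1).
Proof. exact: (piece_of omega0 theta_per). Qed.

Let theta_shiftn k n : theta (k + n%:Z * p%:Z) = theta k + n%:R * omega.
Proof. exact: (theta_shift theta_per k n%:Z). Qed.

Let f_shiftn t v n : f (t + n%:R * omega) v = f t v.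
Proof.
elim: n => [|n IH]; first by rewrite mul0r addr0.
by rewrite -natr1 mulrDl mul1r addrA f_per.
Qed.

Let G_shift k n : G (k + n%:Z * p%:Z) = sigma ((k %/ p%:Z)%Z + n%:Z).
Proof. by rewrite /G addrC divzMDl ?gt_eqF// addrC. Qed.

Let px k : piece k (G k) x.
Proof. exact: (on_piece_of_flow theta_lt (dX (k := k)) (X0 k) (xX (k := k))). Qed.

(** [f] is [omega]-periodic in time and the impulse moments are invariant under the shift, so only
    the index of [sigma] changes. *)
Let pshift n k : piece k (G (k + n%:Z * p%:Z)) (fun t => x (t + n%:R * omega)).
Proof.
pose k' := k + n%:Z * p%:Z.
apply: (on_piece_of_flow theta_lt (X := fun t => Xk k' (t + n%:R * omega))).
- move=> t kt; apply: is_derive_shift_col.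
  have kt' : theta k' <= t + n%:R * omega by rewrite theta_shiftn lerD2r.
  by have := dX kt'; rewrite /vfield f_shiftn.
- by rewrite -theta_shiftn X0.
- move=> t kt tk; apply: xX; first by rewrite theta_shiftn ltrD2r.
  by rewrite /k' addrAC theta_shiftn lerD2r.
Qed.

(** The right-hand side is bounded along a bounded solution. The constant is the same for all
    pieces, giving uniform continuity on them and an interval of fixed length in the separation
    step. *)
Lemma solution_lipschitz : exists2 Lx : R, 0 <= Lx & forall k s t,
  theta k < s -> s <= theta (k + 1) -> theta k < t -> t <= theta (k + 1) ->
  enorm (x s - x t) <= Lx * `|s - t|.
Proof.
have [KA KA0 HKA] := enorm_mulmx_bound A.
pose Q := KA * D + Mf + Mg.
have D0 : 0 <= D by apply: le_trans (xD 0); exact: enorm_ge0.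
have Mf0 : 0 <= Mf by apply: le_trans (f_le 0 0); exact: enorm_ge0.
have Mg0 : 0 <= Mg by apply: le_trans (sigma_le 0); exact: enorm_ge0.
have Q0 : 0 <= Q by rewrite !addr_ge0// mulr_ge0// ltW.
exists (m%:R * Q) => [|k s t]; first by rewrite mulr_ge0.
wlog st : s t / s <= t.
  move=> H ks sk kt tk; have [st|/ltW ts] := leP s t; first exact: H.
  by rewrite enormBC distrC; exact: H.
move=> ks sk kt tk.
rewrite enormBC distrC; apply: le_trans (enorm_le_norm _) _; rewrite -mulrA ler_wpM2l//.
rewrite ger0_norm ?subr_ge0// mulrBr (xX kt tk) (xX ks sk).
apply: (@increment_le_col _ _ (Xk k) (fun u => vf (G k) u (Xk k u)) (fun u => Q * u) (fun=> Q)) => //.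
- by move=> u su ut; apply: dX; apply: ltW (lt_le_trans ks su).
- move=> u _ _; have := is_deriveM (is_derive_cst Q u 1) (is_derive_id u 1).
  by rewrite scaler0 addr0 [_ *: _]mulr1.
- move=> u su ut; apply: le_trans (norm_le_enorm _) _.
  rewrite -(xX (lt_le_trans ks su) (le_trans ut tk)) /vfield.
  have h1 := enormD (A *m x u + f u (x u)) (G k); have h2 := enormD (A *m x u) (f u (x u)).
  have h3 : KA * enorm (x u) <= KA * D by rewrite ler_pM2l.
  have := HKA (x u); have := f_le u (x u); have := sigma_le (k %/ p%:Z)%Z.
  rewrite -/(G k) /Q; lra.
Qed.

(** Two errors, each at most [eps / 4]: the unknown bounded difference at index [j1 - N], forgotten
    after [N] contractions, and the forcing differences on the finitely many pieces from there to
    [j2], small for large [n]. *)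
Lemma shift_converges (zeta : nat -> nat) :
  (forall a b : int, forall eps : R, 0 < eps -> \forall n \near \oo,
     forall k : int, (a <= k <= b)%R ->
       enorm (sigma (k + (zeta n)%:Z)%R - sigma k) < eps) ->
  forall S : set R, compact S -> forall eps, 0 < eps ->
    \forall n \near \oo, forall t, S t ->
      enorm (x (t + (zeta n)%:R * omega) - x t) < eps.
Proof.
move=> Hz S cS eps eps0.
have [T HT] : exists T : R, forall t, S t -> `|t| <= T.
  have [T0 [_ HT0]] := compact_bounded cS.
  by exists (T0 + 1) => t St; apply: HT0 St; rewrite ltrDl.
have [j1 /andP[j1T _]] := pieceE (- T); have [j2 /andP[_ Tj2]] := pieceE T.
have e40 : 0 < eps / 4 by rewrite divr_gt0.
have [N HN] := geometric_small (K * (K * (D + D))) (ltW rho0) rho1 e40.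
have Kr : 0 < K * (K / (1 - rho) + 1).
  by rewrite mulr_gt0// addr_gt0// divr_gt0// subr_gt0.
(* [c] is the forcing tolerance: accumulated over all earlier pieces and added on the last one, it
   costs exactly [eps / 4]. *)
have [c c0 cE] : exists2 c, 0 < c & K * (K * c / (1 - rho) + c) = eps / 4.
  exists (eps / 4 / (K * (K / (1 - rho) + 1))); first exact: divr_gt0.
  rewrite -[RHS](divfK (lt0r_neq0 Kr)); ring.
have := Hz ((j1 - N%:Z) %/ p%:Z)%Z (j2 %/ p%:Z)%Z c c0.
apply: filterS => n Hn t St.
have [k /andP[kt tk]] := pieceE t.
have /ler_normlP [tT1 tT2] := HT t St.
have k1 : j1 <= k by rewrite -ltzD1 ltNge; apply/negP => /thle; lra.
have k2 : k <= j2 by rewrite -ltzD1 ltNge; apply/negP => /thle; lra.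
have range j : j1 - N%:Z <= j -> j <= j2 -> enorm (G (j + (zeta n)%:Z * p%:Z) - G j) <= c.
  move=> h1 h2; rewrite G_shift; apply/ltW/Hn; apply/andP; split.
    by apply: lez_pdiv2r.
  by apply: lez_pdiv2r.
have [l kE] : exists l : nat, k = j1 - N%:Z + Posz (addn N l).
  exists (absz (k - j1)%R); rewrite PoszD addrA subrK.
  by rewrite abszE ger0_norm ?subr_ge0// addrC subrK.
pose y t := x (t + (zeta n)%:R * omega).
have := iterate_diff rho0 rho1 K1 diffH (k0 := j1 - N%:Z) (n := addn N l)
    (gam1 := fun j => G (j + (zeta n)%:Z * p%:Z)) (gam2 := G) (y1 := y) (y2 := x) (ltW c0).
rewrite -kE => I.
have {}I := I (fun j h1 h2 => And3 (@pshift (zeta n) j) (px j) (range j h1 (le_trans (ltW h2) k2))).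
have jN : j1 - N%:Z <= k by apply: le_trans k1; rewrite gerBl.
have [_ /(_ t kt tk) H] := diffH (@pshift (zeta n) k) (px k) (range k jN k2).
have nb k' : nu k' (y (theta k') - x (theta k')) <= K * (D + D).
  apply: le_trans (nu_enorm _ _) _; rewrite ler_pM2l//.
  by apply: le_trans (enormB _ _) _; apply: lerD; exact: xD.
have h1 : rho ^+ addn N l * nu (j1 - N%:Z) (y (theta (j1 - N%:Z)) - x (theta (j1 - N%:Z))) <=
    K * (D + D) * rho ^+ N.
  have D0 : 0 <= D by apply: le_trans (xD 0); exact: enorm_ge0.
  rewrite mulrC; apply: ler_pM; last 1 first.
  - by rewrite exprD ler_piMr ?exprn_ge0 ?exprn_ile1// ltW.
  - by rewrite -(pmulr_rge0 _ K0); apply: le_trans (enorm_nu _ _); exact: enorm_ge0.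
  - by rewrite exprn_ge0// ltW.
  - exact: nb.
apply: le_lt_trans H _; apply: (@le_lt_trans _ _ (eps / 4 + eps / 4)); last by lra.
apply: (@le_trans _ _ (K * (K * (D + D) * rho ^+ N + (K * c / (1 - rho) + c)))).
  by rewrite ler_pM2l// addrA lerD2r; apply: le_trans I _; rewrite lerD2r.
by rewrite mulrDr cE lerD2r mulrA.
Qed.

(* On the piece after [theta (q * p)] the difference [psi] of the solution and
   its shift has the jump of [sigma] as a forcing term, so by the mean value
   theorem a coordinate of [psi] cannot stay small on the middle third of the
   piece; the Lipschitz bound then gives an interval of fixed length. *)
Lemma shift_separated delta0 : 0 < delta0 ->
  exists eps0 r : R, 0 < eps0 /\ 0 < r /\ forall n q : nat,
    delta0 <= enorm (sigma (n%:Z + q%:Z)%R - sigma q%:Z) ->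
    exists2 tau, theta 0 + q%:R * omega <= tau & forall t, tau - r <= t -> t <= tau + r ->
      eps0 <= enorm (x (t + n%:R * omega) - x t).
Proof.
move=> del0.
have [KA KA0 HKA] := enorm_mulmx_bound A.
have [Lx Lx0 HLx] := solution_lipschitz.
pose l := theta 1 - theta 0.
have l0 : 0 < l by rewrite subr_gt0; apply: theta_lt.
pose d1 := delta0 / (m%:R + 1).
have m1 : 0 < m%:R + 1 :> R by rewrite ltr_wpDl.
have d10 : 0 < d1 by rewrite divr_gt0.
have den : 0 < 12 + 2 * (KA + Lf) * l by rewrite addr_gt0// !mulr_gt0// addr_gt0.
have [eps0 eps00 epsE] : exists2 e, 0 < e & e * (12 + 2 * (KA + Lf) * l) = d1 * l.
  by exists (d1 * l / (12 + 2 * (KA + Lf) * l)); [rewrite divr_gt0// mulr_gt0|rewrite divfK// gt_eqF].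
have Lx1 : 0 < 2 * Lx + 1 by rewrite ltr_wpDl// mulr_ge0.
(* [l / 4 < l / 3] keeps the interval around a point of the middle third inside the piece; the other
   bound limits the variation of [psi], at most [2 * Lx * r], to [eps0]. *)
pose r := Num.min (l / 4) (eps0 / (2 * Lx + 1)).
have r0 : 0 < r by rewrite /r lt_min !divr_gt0.
have : r <= r by []; rewrite {2}/r le_min => /andP[rl]; rewrite ler_pdivlMr// => rL.
exists eps0, r; split=> //; split=> // n q Hd.
pose k := q%:Z * p%:Z.
have thk : theta k = theta 0 + q%:R * omega by rewrite -theta_shiftn add0r.
have thk1 : theta (k + 1) = theta k + l.
  by rewrite thk addrC theta_shiftn /l; ring.
have Gk : G k = sigma q%:Z by rewrite /G mulzK// gt_eqF.
have Gkn : G (k + n%:Z * p%:Z) = sigma (n%:Z + q%:Z).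
  by rewrite G_shift -/(G k) /k mulzK ?gt_eqF// addrC.
pose y t := x (t + n%:R * omega).
have [dy _ _] := @pshift n k; have [dx _ _] := px k.
rewrite Gkn in dy; rewrite Gk in dx.
set Dl := sigma (n%:Z + q%:Z) - sigma q%:Z in Hd.
(* Otherwise the norm of [Dl] would be at most [m * d1 < delta0]. *)
have [i Di] : exists i, d1 < `|Dl i 0|.
  have [/existsP //|] := boolP [exists i, d1 < `|Dl i 0|].
  rewrite negb_exists => /forallP H.
  have : `|Dl| <= d1 by apply: norm_le_coord => [|i]; [exact: ltW|rewrite leNgt; exact: H].
  move=> H1; have := enorm_le_norm Dl; have : m%:R * `|Dl| <= m%:R * d1 by rewrite ler_wpM2l.
  have : m%:R * d1 + d1 = delta0 by rewrite /d1; field; rewrite gt_eqF.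
  lra.
pose psi t := y t - x t.
pose dpsi t := vfield A f (sigma (n%:Z + q%:Z)) t (y t) - vfield A f (sigma q%:Z) t (x t).
have dpsiP t : theta k < t -> t < theta (k + 1) -> is_derive t 1 (fun s => psi s i 0) (dpsi t i 0).
  move=> kt tk; apply: (is_derive_colP _ _ _).1.
  by apply: is_deriveB; [exact: dy|exact: dx].
have dpsi_near t : `|dpsi t i 0 - Dl i 0| <= (KA + Lf) * enorm (psi t).
  have -> : dpsi t i 0 - Dl i 0 = (A *m psi t + (f t (y t) - f t (x t))) i 0.
    by rewrite /dpsi /vfield /psi /Dl mulmxBr !mxE; ring.
  apply: le_trans (coord_le_enorm _ _) _; apply: le_trans (enormD _ _) _.
  by rewrite mulrDl lerD.
have [s [sa sb Hs]] : exists s, [/\ theta k + l / 3 <= s, s <= theta k + 2 * l / 3 &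
    2 * eps0 <= enorm (psi s)].
  apply: contrapT => H.
  have small s : theta k + l / 3 <= s -> s <= theta k + 2 * l / 3 -> enorm (psi s) < 2 * eps0.
    move=> h1 h2; rewrite ltNge; apply/negP => h3; apply: H; by exists s.
  pose a := theta k + l / 3; pose b := theta k + 2 * l / 3.
  have ab : a < b by rewrite /a /b; lra.
  have inside s : a <= s -> s <= b -> theta k < s /\ s < theta (k + 1).
    by rewrite /a /b thk1 => h1 h2; split; lra.
  have [||c /itvP cab E] := @MVT R (fun s => psi s i 0) (fun s => dpsi s i 0) a b ab.
  - move=> s /itvP sab; have [||h1 h2] := inside s; rewrite ?sab//; exact: dpsiP.
  - apply: derivable_within_continuous => s /itvP sab.
    have [||h1 h2] := inside s; rewrite ?sab//.
    by have [] := dpsiP s h1 h2.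
  have ac : a <= c by rewrite cab.
  have cb : c <= b by rewrite cab.
  have h1 : `|psi b i 0| < 2 * eps0 by apply: le_lt_trans (coord_le_enorm _ _) (small b (ltW ab) _).
  have h2 : `|psi a i 0| < 2 * eps0 by apply: le_lt_trans (coord_le_enorm _ _) (small a _ (ltW ab)).
  have h3 : `|dpsi c i 0| * (l / 3) < 4 * eps0.
    have -> : l / 3 = b - a by rewrite /a /b; field.
    have ba0 : 0 <= b - a by rewrite subr_ge0 ltW.
    rewrite -[b - a]ger0_norm// -normrM -E.
    by apply: le_lt_trans (ler_normB _ _) _; lra.
  have h4 := dpsi_near c.
  have h5 : (KA + Lf) * enorm (psi c) <= (KA + Lf) * (2 * eps0).
    by rewrite ler_wpM2l ?addr_ge0 ?ltW// small.
  have h6 := ler_normD (Dl i 0 - dpsi c i 0) (dpsi c i 0).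
  rewrite subrK [`|Dl i 0 - _|]distrC in h6.
  have h7 : d1 - (KA + Lf) * (2 * eps0) <= `|dpsi c i 0| by lra.
  have l30 : 0 < l / 3 by rewrite divr_gt0.
  have := ler_wpM2r (ltW l30) h7; lra.
exists s; first by rewrite -thk; lra.
move=> t ts st.
have h1 := HLx k s t ltac:(lra) ltac:(lra) ltac:(lra) ltac:(lra).
pose k' := k + n%:Z * p%:Z.
have tk' : theta k' = theta k + n%:R * omega by rewrite theta_shiftn.
have tk1' : theta (k' + 1) = theta (k + 1) + n%:R * omega by rewrite /k' addrAC theta_shiftn.
have h2 := HLx k' (s + n%:R * omega) (t + n%:R * omega) ltac:(lra) ltac:(lra) ltac:(lra) ltac:(lra).
have -> : x (t + n%:R * omega) - x t = psi t by [].
have h3 : `|s - t| <= r by rewrite ler_norml; apply/andP; split; lra.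
have h4 : s + n%:R * omega - (t + n%:R * omega) = s - t by ring.
rewrite h4 in h2.
have h5 : enorm (psi s - psi t) <= enorm (x (s + n%:R * omega) - x (t + n%:R * omega)) + enorm (x s - x t).
  have -> : psi s - psi t = (x (s + n%:R * omega) - x (t + n%:R * omega)) - (x s - x t).
    by rewrite /psi /y; apply/matrixP => a b; rewrite !mxE; ring.
  exact: enormB.
have h6 := enorm_triangle (psi t) (psi s) 0; rewrite !subr0 in h6.
have h7 : Lx * `|s - t| <= Lx * r by rewrite ler_wpM2l.
have h8 : 0 <= r by exact: ltW.
lra.
Qed.

(** The witnesses are [mu n = zeta n * omega] and a point [tau n] in the first piece of period
    [et n], so both diverge with the sequences for [sigma]. *)
Theorem solution_unpredictable : unpredictable_seq sigma -> unpredictable_fun theta x.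
Proof.
move=> [_ [delta0 [zeta [et [del0 pos inf conv sep]]]]].
have [Lx Lx0 HLx] := solution_lipschitz.
have toinf (u : nat -> nat) (v : nat -> R) (a : R) : (forall M : nat, \forall n \near \oo, (M <= u n)%N) ->
    (forall n, a + (u n)%:R * omega <= v n) -> v @ \oo --> +oo.
  move=> Hu uv; apply/cvgryPge => b.
  have := Hu (Num.truncn (`|b - a| / omega)).+1; apply: filterS => n Hn.
  apply: le_trans (uv n); rewrite -lerBlDl.
  apply: le_trans (ler_norm _) _; rewrite -ler_pdivrMr//.
  have ge0 : 0 <= `|b - a| / omega by rewrite divr_ge0// ltW.
  have /andP[_ /ltW hb] := truncn_itv ge0.
  by apply: le_trans hb _; rewrite ler_nat.
split.
- by exists D.
- move=> t nt; have [k /andP[kt]] := pieceE t.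
  rewrite le_eqVlt => /predU1P[tk|tk]; first by case: nt; exists (k + 1).
  by have [dx _ _] := px k; exact: is_derive_continuous (dx t kt tk).
- by move=> k; have [_ + _] := px (k - 1); rewrite subrK.
- by move=> k; have [_ _ [r [xr _]]] := px k; exists r.
- have [eps0 [r [eps00 [r0 Hsep]]]] := shift_separated del0.
  have [tau Htau] := choice (fun n => let: ex_intro2 tau h1 h2 := Hsep _ _ (sep n) in
    ex_intro (fun tau => theta 0 + (et n)%:R * omega <= tau /\ forall t, tau - r <= t -> t <= tau + r ->
      eps0 <= enorm (x (t + (zeta n)%:R * omega) - x t)) tau (conj h1 h2)).
  exists eps0, r, (fun n => (zeta n)%:R * omega), tau; split => //.
  + split; first by apply: (toinf zeta _ 0) => [M|n]; [exact: (inf M).1|rewrite add0r].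
    by apply: (toinf et _ (theta 0)) => [M|n]; [exact: (inf M).2|exact: (Htau n).1].
  + move=> eps e0; exists (eps / (Lx + 1)); first by rewrite divr_gt0// ltr_wpDl.
    move=> s1 s2 [k [/andP[h1 h2] /andP[h3 h4]]]; rewrite ltr_pdivlMr ?ltr_wpDl// => h5.
    apply: le_lt_trans (HLx k s1 s2 h1 h2 h3 h4) _.
    by have := normr_ge0 (s1 - s2); lra.
  + exact: shift_converges.
  + by move=> n t /andP[h1 h2]; apply: (Htau n).2.
Qed.

End Unpredictability.

Theorem theorem3p1 (R : realType) (m p : nat) (omega : R)
  (A B : 'M[R]_m) (f : R -> 'cV[R]_m -> 'cV[R]_m) (h : 'cV[R]_m -> 'cV[R]_m)
  (theta : int -> R) (sigma : int -> 'cV[R]_m) (g : R -> 'cV[R]_m)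
  (Msigma Mf Mh Lf Lh N lambda : R) :
  0 < omega ->
  continuous (fun q : R * 'cV[R]_m => f q.1 q.2) ->
  continuous h ->
  (forall t x, f (t + omega) x = f t x) ->
  (forall k1 k2 : int, (k1 < k2)%R -> theta k1 < theta k2) ->
  (forall k : int, theta (k + p%:Z)%R = theta k + omega) ->
  0 < Msigma -> (forall k, enorm (sigma k) <= Msigma) ->
  (forall (k : int) (t : R),
     theta (k * p%:Z)%R < t <= theta ((k + 1) * p%:Z)%R -> g t = sigma k) ->
  (* (A1) *)
  A *m B = B *m A -> \det (1%:M + B) != 0 ->
  (* (A2) : log(I+B) is a (complex) logarithm of I+B commuting with A *)
  (exists L : 'M[complex.complex R]_m,
     [/\ cmexp_is L (cmx (1%:M + B)), L *m cmx A = cmx A *m L &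
         forall z, eigenvalue (cmx A + (complex.Complex (p%:R / omega) 0) *: L) z ->
           complex.Re z < 0]) ->
  (* (A3) *)
  0 < Mf -> 0 < Mh ->
  (forall t x, enorm (f t x) <= Mf) -> (forall x, enorm (h x) <= Mh) ->
  (* (A4) *)
  0 < Lf -> 0 < Lh ->
  (forall t x1 x2, enorm (f t x1 - f t x2) <= Lf * enorm (x1 - x2)) ->
  (forall x1 x2, enorm (h x1 - h x2) <= Lh * enorm (x1 - x2)) ->
  (* bound on the matriciant U(t,s) = e^{A(t-s)} (I+B)^{i([s,t))} *)
  0 < N -> 0 < lambda ->
  (forall (s t : R) (n : nat), s <= t -> icount theta s t n ->
     opnorm (mexp ((t - s) *: A) *m (1%:M + B) ^+ n) <= N * expR (- lambda * (t - s))) ->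
  (* (A5) *)
  N * (Lf / lambda + p%:R * Lh / (1 - expR (- lambda * omega))) < 1 ->
  (* (A6) *)
  N * Lf + p%:R / omega * ln (1 + N * Lh) < lambda ->
  (* (A7) *)
  Lh * opnorm (invmx (1%:M + B)) < 1 ->
  unpredictable_seq sigma ->
  exists x : R -> 'cV[R]_m,
    (solution A B f g h theta x /\ unpredictable_fun theta x /\
       asymp_stable A B f g h theta x) /\
    forall y : R -> 'cV[R]_m,
      solution A B f g h theta y /\ unpredictable_fun theta y /\
        asymp_stable A B f g h theta y -> y = x.
Proof.
move=> omega0 fcont _ f_per theta_lt theta_per Ms0 sigma_le g_sigma AB _ _ Mf0 Mh0 f_le h_le
  Lf0 Lh0 f_lip h_lip N0 lambda0 opn_le _ A6 _ unp.
(* [p = 0] would give [theta 0 = theta 0 + omega]. *)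
have p0 : (0 < p)%N.
  rewrite lt0n; apply/eqP => p_eq0; have := theta_per 0.
  by rewrite p_eq0 addr0; lra.
have AC : A *m (1%:M + B) = (1%:M + B) *m A.
  by rewrite mulmxDr mulmxDl mulmx1 mul1mx AB.
have [nu [rho [K [[rho0 rho1 K1] enorm_nu nu_enorm nu_step nu_piece]]]] :=
  impulsive_contraction omega0 p0 theta_lt theta_per AC N0 lambda0 Lf0 Lh0 opn_le A6.
have [Kp Kp1 partialH] := enorm_piece omega0 theta_lt AC N0 lambda0 Lf0 Lh0 opn_le A6.
have pieceE := piece_of omega0 theta_per.
pose G (k : int) := sigma (k %/ p%:Z)%Z.
(* By Euclidean division piece [k] lies inside period [k %/ p], on which [g] is constant. *)
have gG k t : theta k < t -> t <= theta (k + 1) -> g t = G k.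
  have p1 : (0 < p%:Z)%R by [].
  have kE := divz_eq k p%:Z; have km := ltz_pmod k p1.
  have k0 : (0 <= (k %% p%:Z)%Z)%R by rewrite modz_ge0// gt_eqF.
  move=> kt tk; apply: g_sigma; apply/andP; split.
    by apply: le_lt_trans kt; apply: (theta_le theta_lt); rewrite [leRHS]kE lerDl.
  apply: le_trans tk _; apply: (theta_le theta_lt).
  by rewrite {1}kE mulrDl mul1r -addrA lerD2l lezD1.
have diffH := on_piece_diff theta_lt f_lip h_lip nu_step nu_piece.
have boundH := on_piece_bound theta_lt Mf0 Mh0 Ms0 Lf0 Lh0 f_le h_le nu_step nu_piece.
have flowH := flow_exists A fcont Lf0 f_le f_lip.
have c00 : 0 <= Mf + Msigma + Mh by rewrite !addr_ge0// ltW.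
have [x [Xk [D [xX dX X0 xD]]]] := bounded_solution_exists theta_lt pieceE
  (piece_inj theta_lt) rho0 rho1 K1 c00 enorm_nu nu_enorm
  (fun k => sigma_le (k %/ p%:Z)%Z) diffH boundH flowH.
have px k : on_piece A B f h theta k (G k) x.
  exact: (on_piece_of_flow theta_lt (dX k) (X0 k) (xX k)).
exists x; split=> [|y [soly [[[My yM] _ _ _ _] _]]].
  split; first exact: (pieces_solution pieceE gG).
  split.
    exact: (solution_unpredictable omega0 p0 theta_lt theta_per f_per rho0 rho1 K1 Lf0
      enorm_nu nu_enorm f_lip f_le sigma_le diffH xX dX X0 xD).
  exact: (asymp_stable_of_pieces theta_lt pieceE gG rho0 rho1 K1 Kp1 enorm_nu nu_enorm
    f_lip diffH partialH px).
(* Unpredictable functions are bounded by definition, so uniqueness among bounded solutions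
   applies. *)
exact: (bounded_unique pieceE rho0 rho1 K1 nu_enorm diffH
  (fun k => solution_piece theta_lt gG k soly) px yM xD).
Qed.
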